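(* Let $\{Z_n\}_{n\ge1}$ be a sequence of i.i.d. Gaussian random variables $N(\alpha,\beta^2)$ (mean $\alpha\in\mathbb{R}$, standard deviation $\beta>0$), and let $\{a_n\}_{n\ge1}$, $\{b_n\}_{n\ge1}$ be two non-increasing sequences of positive real numbers such that $\sum_{n=1}^{\infty}a_n<\infty$, $\sum_{n=1}^{\infty}b_n<\infty$, $$\sum_{n=1}^{\infty}\left(1-\frac{a_n/\|a\|_2}{b_n/\|b\|_2}\right)\text{ converges, and }\sum_{n=1}^{\infty}\left(1-\frac{a_n/\|a\|_2}{b_n/\|b\|_2}\right)^2<\infty.$$ Then, as $r\rightarrow\infty$, $$\mathbb{P}\left\{\sum_{n=1}^{\infty}a_n|Z_n|\geq r\|a\|_2\beta+|\alpha|\sum_{n=1}^{\infty} a_n\right\}\sim\mathbb{P}\left\{\sum_{n=1}^{\infty}b_n|Z_n|\geq r\|b\|_2\beta+|\alpha|\sum_{n=1}^{\infty} b_n\right\}.$$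
   Context: For a real sequence $a=\{a_n\}$, $\|a\|_2=\left(\sum_{n=1}^{\infty}a_n^2\right)^{1/2}$. The notation $F(r)\sim G(r)$ as $r\to\infty$ means $F(r)/G(r)\to1$ as $r\to\infty$. *)

(* Defs.v *)
From HB Require Import structures.
From mathcomp Require Import all_boot all_order all_algebra finmap.
From mathcomp Require Import all_classical all_reals all_analysis.

Set Implicit Arguments.
Unset Strict Implicit.
Unset Printing Implicit Defensive.

Import Order.TTheory GRing.Theory Num.Theory.
Import numFieldNormedType.Exports.

Local Open Scope classical_set_scope.
Local Open Scope ring_scope.

(* Sequences indexed from 1 on paper are indexed from 0 here. *)

(* Meaningful when the squares are summable, which holds for every summable
   sequence of nonnegative reals. *)
Definition l2norm (R : realType) (a : R^nat) : R :=
  Num.sqrt (limn (series (fun n => a n ^+ 2))).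

Definition mutually_independent (d d' : measure_display)
    (T : measurableType d) (T' : measurableType d') (R : realType)
    (P : probability T R) (I : choiceType) (X : I -> {RV P >-> T'}) : Prop :=
  forall (J : {fset I}) (B : I -> set T'),
    (forall i, i \in J -> measurable (B i)) ->
    P (\bigcap_(i in [set` J]) (X i @^-1` B i)) =
    (\prod_(i <- J) P (X i @^-1` B i))%E.

(* The laws are compared on measurable sets only, since the values that the
   underlying set functions take elsewhere carry no meaning. *)
Definition has_law (d d' : measure_display)
    (T : measurableType d) (T' : measurableType d') (R : realType)
    (P : probability T R) (X : {RV P >-> T'}) (mu : set T' -> \bar R) : Prop :=
  forall B : set T', measurable B -> distribution P X B = mu B.

Definition asymp_equiv (R : realType) (F G : R -> R) : Prop :=
  F r / G r @[r --> +oo] --> (1 : R).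

(* P {sum_n a_n |Z_n| >= t}; the random series has nonnegative terms and is
   summed in the extended reals, so that the event is defined everywhere. *)
Definition tail_prob (d : measure_display) (T : measurableType d)
    (R : realType) (P : probability T R) (Z : nat -> {RV P >-> R})
    (a : R^nat) (t : R) : R :=
  fine (P [set w | (t%:E <= \sum_(0 <= n <oo) (a n * `|Z n w|)%:E)%E]).

(* Main.v *)
Require Import Defs.
From HB Require Import structures.
From mathcomp Require Import all_boot all_order all_algebra finmap.
From mathcomp Require Import all_classical all_reals all_analysis.
From mathcomp Require Import measurable_realfun ring lra.

(** Why the two tails are equivalent.

    Put m = |alpha| / beta, Y_n = |Z_n| / beta - m, and let c_n be a_n or b_n
    divided by its l2 norm, so that the squares of the c_n add up to 1. After
    division by the l2 norm and by beta, the event is that the sum of the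
    c_n Y_n is at least r.

    Up to the cut at -m and to the folded part of the law, Y_n is a standard
    Gaussian variable. Tilting its law by e^(t y) and recentring at t gives a
    density p_t (fold_density), while the Laplace transform of Y_n is
    e^(t^2/2) h(t) with h = fold_mass, a bounded function with h(0) = 1. Tilting
    the whole sum at rate r therefore yields, since the squares add up to 1,

      P(event) = e^(-r^2/2) (prod_n h(r c_n)) E [e^(-r X); X >= 0],

    where X is the sum of c_n X_n with independent X_n of density p_(r c_n).
    This is smears_tilt, for partial sums.

    The last factor. When t grows, p_t tends to the standard Gaussian density
    phi, both uniformly and in L1 (fold_density_close). In terms of the operators
    smear, which take v to the function x |-> E v(x + c X), r times the last
    factor is a composition of smearings of the exponential density
    w(x) = r e^(-r x). The first smearing makes w bounded and Lipschitz
    uniformly in r; replacing its density by phi costs the uniform distance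
    between the densities. The next smearings are contractions and preserve the
    bound and the Lipschitz constant, and replacing the n-th density by phi costs
    at most a multiple of the L1 distance and at most a multiple of c_n. Since
    the c_n are summable, the total cost tends to 0 by dominated convergence
    (tilted_quotient_close). Gaussian smearings compose to a single one of
    variance 1, so that the last factor is equivalent to gauss_value r / r, which
    does not depend on the weights. The smoothing by a single term of the sum plays
    the part of a local limit theorem.

    The product. It remains to see that the sum of
    log h(r u_n) - log h(r v_n) tends to 0, where u_n and v_n are the two
    normalized sequences (log_mass_sum_close). Let G(t) = t h'(t) / h(t), and let
    x_n = u_n / v_n - 1. Beyond a fixed rank the sum differs from that of
    G(r v_n) x_n by at most a multiple of the sum of the x_n^2. The function G
    has bounded variation on the half-line, so along the monotone sequence r v_n
    Abel summation bounds the tails of the latter series by those of the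
    convergent series of the x_n, uniformly in r. For each fixed n the terms tend
    to 0 as r grows because h has a limit at infinity. *)

Set Implicit Arguments.
Unset Strict Implicit.
Unset Printing Implicit Defensive.

Import Order.TTheory GRing.Theory Num.Theory.
Import numFieldNormedType.Exports.

Local Open Scope classical_set_scope.
Local Open Scope ring_scope.

(** * Integrals against image measures and densities *)

Section image_measure.
Context d d' (T1 : measurableType d) (T2 : measurableType d') (R : realType).

(** The set function pushforward, bundled as a measure so that it can be scaled
    and integrated against. *)
Definition image_measure (m : {measure set T1 -> \bar R}) (f : T1 -> T2)
    (mf : measurable_fun setT f) : {measure set T2 -> \bar R} :=
  measure_function_pushforward__canonical__measure_function_Measure m mf.

Lemma ge0_integral_image_measure m f (mf : measurable_fun setT f)
    (g : T2 -> \bar R) : measurable_fun setT g -> (forall y, 0 <= g y)%E ->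
  (\int[image_measure m mf]_y g y = \int[m]_x g (f x))%E.
Proof. by move=> mg g0; rewrite ge0_integral_pushforward//= => y _. Qed.

End image_measure.

Section density.
Context d (T : measurableType d) (R : realType)
  (mu nu : {measure set T -> \bar R}).

Import HBNNSimple.

(** Holds for indicators by definition of the density, then for simple
    functions by linearity, and passes to monotone limits. *)
Lemma ge0_integral_density (p : T -> R) (v : T -> \bar R) :
  measurable_fun setT p -> (forall y, 0 <= p y) ->
  (forall A, measurable A -> nu A = \int[mu]_(y in A) (p y)%:E)%E ->
  measurable_fun setT v -> (forall y, 0 <= v y)%E ->
  (\int[nu]_y v y = \int[mu]_y (v y * (p y)%:E))%E.
Proof.
move=> mp p0 nuE mv v0.
pose h := nnsfun_approx measurableT mv.
have mpE : measurable_fun setT (EFin \o p) by exact/measurable_EFinP.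
have -> : (\int[nu]_x v x = lim (\int[nu]_x (EFin \o h n) x @[n --> \oo]))%E.
  have fE x : v x = lim ((EFin \o h n) x @[n --> \oo]).
    by apply/esym/cvg_lim => //; exact: cvg_nnsfun_approx.
  under eq_integral => x _ do rewrite fE.
  apply: monotone_convergence => //.
  - by move=> n; exact/measurable_EFinP/measurable_funTS.
  - by move=> n x _ /=; rewrite lee_fin.
  - by move=> x _ a b ab; rewrite lee_fin; exact/lefP/nd_nnsfun_approx.
have -> : (\int[mu]_x (v x * (p x)%:E) =
    lim (\int[mu]_x ((EFin \o h n) x * (p x)%:E) @[n --> \oo]))%E.
  have fg x : (v x * (p x)%:E = lim ((EFin \o h n) x * (p x)%:E @[n --> \oo]))%E.
    apply/esym/cvg_lim => //; apply: cvgeZr => //.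
    exact: cvg_nnsfun_approx.
  under eq_integral => x _ do rewrite fg.
  apply: monotone_convergence => // [n|n x _|x _ a b ab].
  - by apply: emeasurable_funM => //; exact/measurable_EFinP/measurable_funTS.
  - by rewrite mule_ge0//= lee_fin.
  - rewrite lee_wpmul2r//= ?lee_fin//; exact/lefP/nd_nnsfun_approx.
congr (lim (_ @ \oo)); apply/funext => n.
transitivity (\int[nu]_x
   (\sum_(y \in range (h n)) (y * \1_(h n @^-1` [set y]) x)%:E))%E.
  by apply: eq_integral => t tE; rewrite /= fimfunE -fsumEFin.
have indich r : measurable_fun setT (fun x : T => (r * \1_(h n @^-1` [set r]) x)%:E).
  by apply/measurable_EFinP; apply: measurable_funM.
rewrite ge0_integral_fsum//; last by move=> m y Ey; exact: nnfun_muleindic_ge0.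
transitivity (\int[mu]_x (\sum_(y \in range (h n))
    ((y * \1_(h n @^-1` [set y]) x)%:E * (p x)%:E)))%E; last first.
  apply: eq_integral => x xE.
  rewrite -ge0_mule_fsuml => [|y]; last exact: nnfun_muleindic_ge0.
  by rewrite fsumEFin // -(fimfunE _ x).
rewrite ge0_integral_fsum//; last 2 first.
  - by move=> y; apply: emeasurable_funM.
  - by move=> m y Ey; rewrite mule_ge0 ?[(0 <= (p _)%:E)%E]lee_fin//;
      exact: nnfun_muleindic_ge0.
apply: eq_fsbigr => r rhn.
under eq_integral do rewrite EFinM.
rewrite integralZl_indic_nnsfun => //.
under [RHS]eq_integral do rewrite EFinM -muleA.
rewrite [RHS]ge0_integralZl//.
- under [in RHS]eq_integral do rewrite muleC.
  rewrite [in RHS](eq_integral ((EFin \o p) \_ (h n @^-1` [set r]))); last first.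
    by move=> x xE; rewrite epatch_indic.
  by rewrite -integral_mkcond -nuE// integral_indic// setIT.
- by apply: emeasurable_funM => //; exact/measurable_EFinP.
- by move=> t Et; rewrite mule_ge0 ?lee_fin.
- by move: rhn; rewrite inE => -[t _ <-]; rewrite lee_fin.
Qed.

End density.

Section integration.
Context {R : realType}.
Local Notation mu := (@lebesgue_measure R).
Implicit Types (f g : R -> R) (u v : R -> \bar R).

(** The measure c times the image of Lebesgue measure under the affine map gives
    every interval its length, hence is Lebesgue measure. *)
Lemma ge0_integral_translate_scale (c x : R) v : 0 < c ->
  measurable_fun setT v -> (forall y, 0 <= v y)%E ->
  (\int[mu]_y v y = c%:E * \int[mu]_s v (x + c * s)%R)%E.
Proof.
move=> c0 mv v0.
have mphi : measurable_fun setT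
    ((fun s => x + c * s) : measurableTypeR R -> measurableTypeR R).
  by apply: measurable_funD => //; apply: measurable_funM.
rewrite -[RHS]/((NngNum (ltW c0))%:num%:E * _)%E.
transitivity (\int[mscale (NngNum (ltW c0)) (image_measure mu mphi)]_y v y)%E.
  apply: eq_measure_integral => A mA _; apply: lebesgue_measure_unique => //.
  move=> _ [[a b]] _ <-; 
  change (mu `]a, b] = c%:E * mu ((fun s => x + c * s)%R @^-1` `]a, b]))%E.
  rewrite (_ : _ @^-1` _ = `](a - x) / c, (b - x) / c]%classic); last first.
    by apply/seteqP; split => s /=; rewrite !in_itv/=;
      rewrite ltr_pdivrMr// ler_pdivlMr// ltrBlDl lerBrDl (mulrC s).
  rewrite !lebesgue_measure_itv/= !lte_fin.
  rewrite ltr_pM2r ?invr_gt0// ltrBDr subrK.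
  case: ifP => _; last by rewrite mule0.
  by rewrite -EFinD -EFinM; congr EFin; field; exact: lt0r_neq0.
by rewrite ge0_integral_mscale// ge0_integral_image_measure.
Qed.

Lemma ge0_integral_reflect v :
  measurable_fun setT v -> (forall y, 0 <= v y)%E ->
  (\int[mu]_s v (- s)%R = \int[mu]_y v y)%E.
Proof.
move=> mv v0.
transitivity (\int[pushforward mu (-%R : _ -> measurableTypeR R)]_y v y)%E.
  by rewrite ge0_integral_pushforward//= => y _.
by apply: eq_measure_integral => A mA _; exact: lebesgue_measureN.
Qed.

End integration.

(** * The standard Gaussian density *)

Section calculus.
Context {R : realType}.
Implicit Types f : R -> R.

Lemma mean_value f f' (x y : R) : x < y ->
  (forall z : R, x <= z <= y -> is_derive z (1 : R) f (f' z)) ->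
  exists2 z, x < z < y & f y - f x = f' z * (y - x).
Proof.
move=> xy df.
have cf : {within `[x, y], continuous f}.
  apply: derivable_within_continuous => z; rewrite in_itv/= => zxy.
  by have [] := df z zxy.
have df' z : z \in `]x, y[%R -> is_derive z (1 : R) f (f' z).
  by rewrite in_itv/= => /andP[xz zy]; apply: df; rewrite !ltW.
have [z] := MVT xy df' cf.
by rewrite in_itv/= => zxy fE; exists z.
Qed.

Lemma lipschitz_of_derive f f' (L : R) : (forall z : R, is_derive z (1 : R) f (f' z)) ->
  (forall z, `|f' z| <= L) -> forall x y, `|f x - f y| <= L * `|x - y|.
Proof.
move=> df f'L x y.
wlog xy : x y / y < x => [H|].
  have [/H//|/H yx|->] := ltgtP y x; last by rewrite !subrr !normr0 mulr0.
  by rewrite distrC (distrC x).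
have [z _ ->] := mean_value xy (fun z _ => df z).
by rewrite normrM ler_wpM2r.
Qed.

End calculus.

Section gaussian_density.
Context {R : realType}.
Local Notation mu := (@lebesgue_measure R).

Definition phi (x : R) : R := normal_pdf 0 1 x.

Lemma phi0E : phi 0 = normal_peak 1.
Proof.
by rewrite /phi normal_pdfE ?oner_neq0// /normal_fun subrr expr0n/= oppr0 mul0r
  expR0 mulr1.
Qed.

Lemma phiE x : phi x = phi 0 * expR (- (x ^+ 2 / 2)).
Proof.
rewrite phi0E /phi normal_pdfE ?oner_neq0// /normal_fun subr0 expr1n.
by congr (_ * expR _); field.
Qed.

Lemma phi0_gt0 : 0 < phi 0.
Proof. by rewrite phi0E normal_peak_gt0// oner_neq0. Qed.

Lemma phi_gt0 x : 0 < phi x.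
Proof. by rewrite phiE mulr_gt0 ?phi0_gt0 ?expR_gt0. Qed.

Lemma phi_ge0 x : 0 <= phi x. Proof. exact/ltW/phi_gt0. Qed.

Lemma phi_le0 x : phi x <= phi 0.
Proof.
by rewrite phiE ler_piMr ?phi_ge0// -[leRHS]expR0 ler_expR oppr_le0
  divr_ge0// sqr_ge0.
Qed.

Lemma phiN x : phi (- x) = phi x.
Proof. by rewrite phiE sqrrN -phiE. Qed.

Lemma phiD x a : phi (x + a) = phi x * expR (- (a * x) - a ^+ 2 / 2).
Proof. by rewrite phiE [in RHS]phiE -mulrA -expRD; congr (_ * expR _); field. Qed.

Lemma phi_anti (x y : R) : 0 <= x <= y -> phi y <= phi x.
Proof.
move=> /andP[x0 xy]; rewrite phiE (phiE x) ler_wpM2l ?phi_ge0// ler_expR lerN2.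
by rewrite ler_wpM2r// lerXn2r ?nnegrE// (le_trans x0).
Qed.

Lemma normal_pdf_phi (m c z : R) : 0 < c ->
  normal_pdf m c z = c^-1 * phi ((z - m) / c).
Proof.
move=> c0; rewrite phiE phi0E normal_pdfE ?gt_eqF// mulrA; congr (_ * _).
  rewrite /normal_peak expr1n mul1r -mulrnAr sqrtrM ?sqr_ge0//.
  by rewrite sqrtr_sqr gtr0_norm// invfM.
by rewrite /normal_fun; congr expR; field; rewrite gt_eqF.
Qed.

Lemma normal_pdf1 (m z : R) : normal_pdf m 1 z = phi (z - m).
Proof. by rewrite normal_pdf_phi// invr1 mul1r mulr1. Qed.

Lemma measurable_phi : measurable_fun [set: R] phi.
Proof. exact: measurable_normal_pdf. Qed.

Lemma continuous_phi : continuous phi.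
Proof. by apply: continuous_normal_pdf; rewrite oner_neq0. Qed.

Lemma integral_phi_shift (a : R) : (\int[mu]_s (phi (s + a))%:E = 1)%E.
Proof.
rewrite -[RHS](integral_normal_pdf (- a) 1); apply: eq_integral => s _.
by rewrite normal_pdf1 opprK.
Qed.

Lemma integral_phi : (\int[mu]_s (phi s)%:E = 1)%E.
Proof. exact: integral_normal_pdf. Qed.

Lemma is_derive_phi (x : R) : is_derive x (1 : R) phi (- x * phi x).
Proof.
have -> : phi = (fun x : R => phi 0 * expR (- (x ^+ 2 / 2))).
  by apply/funext => y; exact: phiE.
apply: is_derive_eq.
by rewrite /GRing.scale/=; field.
Qed.

Lemma phi_lipschitz x y : `|phi x - phi y| <= phi 0 * `|x - y|.
Proof.
apply: (lipschitz_of_derive is_derive_phi) => z.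
rewrite normrM normrN (ger0_norm (phi_ge0 _)) phiE mulrCA ler_piMr ?phi_ge0//.
rewrite expRN ler_pdivrMr ?expR_gt0// mul1r.
apply: le_trans (expR_ge1Dx _).
rewrite -(real_normK (num_real z)).
by have := sqr_ge0 (`|z| - 1); rewrite sqrrB expr1n => ?; nra.
Qed.

(** Bounds the first absolute moment of phi: |s| is at most e^s + e^-s, and
    e^s phi s is e^(1/2) times a translate of phi. *)
Definition phi_moment : R := expR (2^-1) *+ 2.

Lemma phi_moment_ge0 : 0 <= phi_moment.
Proof. by rewrite mulrn_wge0// expR_ge0. Qed.

Lemma integral_norm_phi : (\int[mu]_s (`|s| * phi s)%:E <= phi_moment%:E)%E.
Proof.
have b s : `|s| * phi s <= expR 2^-1 * (phi (s - 1) + phi (s + 1)).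
  have -> : expR 2^-1 * (phi (s - 1) + phi (s + 1)) =
      phi s * (expR s + expR (- s)).
    rewrite 2!phiD -mulrDr mulrCA mulrDr -!expRD.
    by congr (_ * (expR _ + expR _)); field.
  rewrite mulrC ler_wpM2l ?phi_ge0//.
  have := expR_ge1Dx s; have := expR_ge1Dx (- s).
  have := expR_gt0 s; have := expR_gt0 (- s).
  by rewrite ler_norml => ? ? ? ?; apply/andP; split; lra.
have mph a : measurable_fun [set: R] (fun s : R => phi (s + a)).
  by apply: measurableT_comp measurable_phi _; apply: measurable_funD.
apply: (@le_trans _ _
    (\int[mu]_s ((expR 2^-1)%:E * ((phi (s - 1))%:E + (phi (s + 1))%:E)))%E).
  apply: ge0_le_integral => //=.
  - by move=> s _; rewrite lee_fin mulr_ge0// phi_ge0.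
  - apply/measurable_EFinP; apply: measurable_funM; last exact: measurable_phi.
    exact: normr_measurable.
  - by apply/measurable_EFinP; apply: measurable_funM => //; apply: measurable_funD;
      exact: mph.
  - by move=> s _; rewrite -EFinD -EFinM lee_fin.
rewrite ge0_integralZl//=; last 2 first.
  - by apply: emeasurable_funD; apply/measurable_EFinP; exact: mph.
  - by move=> s _; rewrite adde_ge0// lee_fin phi_ge0.
rewrite ge0_integralD//=; last 4 first.
  - by move=> s _; rewrite lee_fin phi_ge0.
  - by apply/measurable_EFinP; exact: mph.
  - by move=> s _; rewrite lee_fin phi_ge0.
  - by apply/measurable_EFinP; exact: mph.
by rewrite !integral_phi_shift -EFinD -EFinM lee_fin mulrDr mulr1.
Qed.

End gaussian_density.

(** * Smearing operators *)

Section smearing.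
Context {R : realType}.
Local Notation mu := (@lebesgue_measure R).
Implicit Types (f g : R -> R) (u v w : R -> \bar R) (c B L C e x : R).

Definition nnmeas v := measurable_fun [set: R] v /\ forall x, (0 <= v x)%E.

Definition nndens f := measurable_fun [set: R] f /\ forall x, 0 <= f x.

(** The bound C on the first absolute moment controls how far smearing moves a
    Lipschitz function. *)
Definition prob_density C f := [/\ nndens f, (\int[mu]_s (f s)%:E = 1)%E &
  (\int[mu]_s (`|s| * f s)%:E <= C%:E)%E].

(** The class preserved by every smearing by a probability density; B and L are
    then uniform along an iteration of any length. *)
Definition bounded_lip B L v := [/\ nnmeas v, forall x, (v x <= B%:E)%E &
  forall x y, (v x <= v y + (L * `|x - y|)%:E)%E].

(** Supremum distance at most e, written without subtraction because the values
    are extended reals. *)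
Definition unif_close e u v :=
  forall x, (u x <= v x + e%:E)%E /\ (v x <= u x + e%:E)%E.

(** If X has density f and is independent of X', the expectation of
    v(x + c X + X') is that of smear f c v (x + X'): sums of independent
    variables become compositions of such operators. *)
Definition smear f c v x : \bar R :=
  (\int[mu]_s (v (x + c * s)%R * (f s)%:E))%E.

Lemma measurable_affine c x : measurable_fun [set: R] (fun s : R => x + c * s).
Proof. by apply: measurable_funD => //; apply: measurable_funM. Qed.

Lemma measurable_smear_integrand f c v x : nndens f -> nnmeas v ->
  measurable_fun [set: R] (fun s => v (x + c * s)%R * (f s)%:E)%E.
Proof.
move=> [mf _] [mv _]; apply: emeasurable_funM; last exact/measurable_EFinP.
by apply: (measurableT_comp mv); exact: measurable_affine.
Qed.

Lemma smear_integrand_ge0 f c v x s : nndens f -> nnmeas v ->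
  (0 <= v (x + c * s)%R * (f s)%:E)%E.
Proof. by move=> [_ f0] [_ v0]; rewrite mule_ge0// lee_fin. Qed.

Lemma nnmeas_smear f c v : nndens f -> nnmeas v -> nnmeas (smear f c v).
Proof.
move=> df dv; split; last first.
  by move=> x; apply: integral_ge0 => s _; exact: smear_integrand_ge0.
pose F (z : R * R) := (v (z.1 + c * z.2)%R * (f z.2)%:E)%E.
apply: (measurable_fun_fubini_tonelli_F (m2 := mu) F) => /=; last first.
  by move=> z; exact: smear_integrand_ge0.
case: dv df => mv _ [mf _].
apply: emeasurable_funM; last first.
  by apply/measurable_EFinP; apply: (measurableT_comp mf).
apply: (measurableT_comp mv); apply: measurable_funD => //.
by apply: measurable_funM => //; exact: measurable_snd.
Qed.

Lemma le_smear f c u v : nndens f -> nnmeas u -> nnmeas v ->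
  (forall x, u x <= v x)%E -> forall x, (smear f c u x <= smear f c v x)%E.
Proof.
move=> df du dv uv x; apply: ge0_le_integral => //.
- by move=> s _; exact: smear_integrand_ge0.
- exact: measurable_smear_integrand.
- exact: measurable_smear_integrand.
- by move=> s _; rewrite lee_wpmul2r// lee_fin; case: df.
Qed.

Lemma smear_cst C f c e x : prob_density C f -> 0 <= e ->
  smear f c (cst e%:E) x = e%:E.
Proof.
move=> [[mf f0] f1 _] e0; rewrite /smear ge0_integralZl//=.
- by rewrite f1 mule1.
- exact/measurable_EFinP.
- by move=> s _; rewrite lee_fin.
Qed.

Lemma smearD f c u v x : nndens f -> nnmeas u -> nnmeas v ->
  smear f c (fun y => u y + v y)%E x = (smear f c u x + smear f c v x)%E.
Proof.
move=> df du dv; rewrite /smear -ge0_integralD//; last 4 first.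
- by move=> s _; exact: smear_integrand_ge0.
- exact: measurable_smear_integrand.
- by move=> s _; exact: smear_integrand_ge0.
- exact: measurable_smear_integrand.
by apply: eq_integral => s _; rewrite ge0_muleDl//; [case: du|case: dv].
Qed.

Lemma nnmeas_cst e : 0 <= e -> nnmeas (cst e%:E).
Proof. by move=> e0; split=> [|x]; [exact: measurable_cst|rewrite lee_fin]. Qed.

Lemma smear_le_add C f c u v e : prob_density C f -> nnmeas u -> nnmeas v ->
  0 <= e -> (forall x, u x <= v x + e%:E)%E ->
  forall x, (smear f c u x <= smear f c v x + e%:E)%E.
Proof.
move=> df du dv e0 uv x.
have df' : nndens f by case: df.
have de := nnmeas_cst e0.
rewrite -(smear_cst c x df e0) -smearD//; apply: le_smear => //.
split=> [|y]; last by case: dv => _ v0; rewrite adde_ge0.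
by apply: emeasurable_funD; [case: dv|case: de].
Qed.

(** Smearing by a probability density is a contraction for the supremum
    distance. *)
Lemma smear_close C f c u v e : prob_density C f -> nnmeas u -> nnmeas v ->
  0 <= e -> unif_close e u v -> unif_close e (smear f c u) (smear f c v).
Proof.
by move=> df du dv e0 uv x; split; apply: (smear_le_add _ df) => // y; case: (uv y).
Qed.

Lemma smear_shift f c v a x :
  smear f c (fun y => v (y + a)) x = smear f c v (x + a).
Proof. by apply: eq_integral => s _; rewrite addrAC. Qed.

Lemma bounded_lip_smear C f c B L v : prob_density C f -> 0 <= B -> 0 <= L ->
  bounded_lip B L v -> bounded_lip B L (smear f c v).
Proof.
move=> df B0 L0 [dv vB vL]; have df' : nndens f by case: df.
split; first exact: nnmeas_smear.
- by move=> x; rewrite -(smear_cst c x df B0); apply: le_smear => //; exact: nnmeas_cst.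
- move=> x y.
  have -> : smear f c v x = smear f c (fun z => v (z + (x - y))) y.
    by rewrite smear_shift addrC subrK.
  apply: (smear_le_add _ df) => //.
  + case: dv => mv v0; split=> //; apply: (measurableT_comp mv).
    exact: measurable_funD.
  + by rewrite mulr_ge0.
  + by move=> z; apply: le_trans (vL _ z) _; rewrite addrAC subrr add0r.
Qed.

(** The point is displaced by c |s|, of mean at most C c. *)
Lemma smear_near_id C f c B L v : prob_density C f -> 0 <= c -> 0 <= L ->
  bounded_lip B L v -> unif_close (C * L * c) (smear f c v) v.
Proof.
move=> df c0 L0 [dv vB vL] x; have [[mf f0] f1 fC] := df.
have df' : nndens f by [].
have cst_v : (\int[mu]_s (v x * (f s)%:E) = v x)%E.
  rewrite ge0_integralZl//=; first by rewrite f1 mule1.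
  - exact/measurable_EFinP.
  - by move=> s _; rewrite lee_fin.
  - by case: dv.
have mabs : measurable_fun [set: R] (fun s : R => (`|s| * f s)%:E).
  apply/measurable_EFinP; apply: measurable_funM => //; exact: normr_measurable.
have err : (\int[mu]_s ((L * c)%:E * (`|s| * f s)%:E) <= (C * L * c)%:E)%E.
  rewrite ge0_integralZl//=; last 2 first.
  - by move=> s _; rewrite lee_fin mulr_ge0.
  - by rewrite lee_fin mulr_ge0.
  rewrite (_ : C * L * c = L * c * C); last by ring.
  by rewrite (EFinM (L * c)); apply: lee_wpmul2l => //; rewrite lee_fin mulr_ge0.
have ge0err s : (0 <= (L * c)%:E * (`|s| * f s)%:E)%E.
  by rewrite -EFinM lee_fin !mulr_ge0.
have merr : measurable_fun [set: R] (fun s => (L * c)%:E * (`|s| * f s)%:E)%E.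
  by apply: emeasurable_funM.
have mvx : measurable_fun [set: R] (fun s => v x * (f s)%:E)%E.
  by apply: emeasurable_funM => //; exact/measurable_EFinP.
have vx0 s : (0 <= v x * (f s)%:E)%E by case: dv => _ ?; rewrite mule_ge0// lee_fin.
have normE s : L * `|c * s| * f s = L * c * (`|s| * f s).
  by rewrite normrM (ger0_norm c0); ring.
split.
- apply: (@le_trans _ _ (v x + \int[mu]_s ((L * c)%:E * (`|s| * f s)%:E))%E);
    last by rewrite leeD2l.
  rewrite -[in X in (_ <= X)%E]cst_v -ge0_integralD//.
  apply: ge0_le_integral => //.
  + by move=> s _; exact: smear_integrand_ge0.
  + exact: measurable_smear_integrand.
  + by apply: emeasurable_funD.
  + move=> s _; rewrite -EFinM -normE EFinM -ge0_muleDl; last 2 first.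
    * by case: dv.
    * by rewrite lee_fin mulr_ge0.
    rewrite lee_wpmul2r ?lee_fin//; apply: le_trans (vL _ x) _.
    by rewrite addrAC subrr add0r.
- apply: (@le_trans _ _ (smear f c v x +
      \int[mu]_s ((L * c)%:E * (`|s| * f s)%:E))%E); last by rewrite leeD2l.
  rewrite -[in X in (X <= _)%E]cst_v -ge0_integralD//; last 2 first.
  + by move=> s _; exact: smear_integrand_ge0.
  + exact: measurable_smear_integrand.
  apply: ge0_le_integral => //.
  + by apply: emeasurable_funD => //; exact: measurable_smear_integrand.
  + move=> s _; rewrite -EFinM -normE EFinM -ge0_muleDl; last 2 first.
    * by case: dv.
    * by rewrite lee_fin mulr_ge0.
    rewrite lee_wpmul2r ?lee_fin//; apply: le_trans (vL x (x + c * s)) _.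
    by rewrite opprD addrA subrr add0r normrN.
Qed.

Lemma smear_le_density f g psi c v x (e : \bar R) : nndens f -> nndens g -> nndens psi ->
  nnmeas v -> (forall s, f s <= g s + psi s) -> (smear psi c v x <= e)%E ->
  (smear f c v x <= smear g c v x + e)%E.
Proof.
move=> df dg dpsi dv fg psie.
apply: (@le_trans _ _ (smear g c v x + smear psi c v x)%E); last by rewrite leeD2l.
rewrite /smear -ge0_integralD//; last 4 first.
- by move=> s _; exact: smear_integrand_ge0.
- exact: measurable_smear_integrand.
- by move=> s _; exact: smear_integrand_ge0.
- exact: measurable_smear_integrand.
apply: ge0_le_integral => //.
- by move=> s _; exact: smear_integrand_ge0.
- exact: measurable_smear_integrand.
- by apply: emeasurable_funD; exact: measurable_smear_integrand.
- move=> s _; rewrite -ge0_muleDr; last 2 first.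
    by case: dg => _ ?; rewrite lee_fin.
    by case: dpsi => _ ?; rewrite lee_fin.
  rewrite -EFinD lee_wpmul2l ?lee_fin//; by case: dv.
Qed.

(** Comparison of two densities through a bound psi of their distance. The two
    lemmas below estimate smear psi c v by the mass of psi when v is bounded,
    and by the supremum of psi when v is integrable. *)
Lemma smear_close_density f g psi c v e : nndens f -> nndens g -> nndens psi ->
  nnmeas v -> (forall s, `|f s - g s| <= psi s) ->
  (forall x, smear psi c v x <= e%:E)%E ->
  unif_close e (smear f c v) (smear g c v).
Proof.
move=> df dg dpsi dv fg psie x; split; apply: (@smear_le_density _ _ psi) => //.
  by move=> s; have := fg s; rewrite ler_distlC; lra.
by move=> s; have := fg s; rewrite ler_distlC; lra.
Qed.

Lemma smear_le_mass psi c v B M x : nndens psi -> nnmeas v -> 0 <= B ->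
  (forall x, v x <= B%:E)%E -> (\int[mu]_s (psi s)%:E <= M%:E)%E ->
  (smear psi c v x <= (B * M)%:E)%E.
Proof.
move=> dpsi dv B0 vB psiM; have [mp p0] := dpsi.
apply: (@le_trans _ _ (smear psi c (cst B%:E) x)).
  by apply: le_smear => //; exact: nnmeas_cst.
rewrite /smear ge0_integralZl//=.
- by rewrite EFinM lee_wpmul2l// lee_fin.
- exact/measurable_EFinP.
- by move=> s _; rewrite lee_fin.
Qed.

Lemma smear_le_sup psi c v D M x : nndens psi -> nnmeas v -> 0 < c -> 0 <= M ->
  (\int[mu]_y v y <= D%:E)%E -> (forall s, psi s <= M) ->
  (smear psi c v x <= (M / c * D)%:E)%E.
Proof.
move=> dpsi dv c0 M0 vD psiM; have [mv v0] := dv.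
have mvx : measurable_fun [set: R] (fun s => v (x + c * s)).
  by apply: (measurableT_comp mv); exact: measurable_affine.
apply: (@le_trans _ _ (\int[mu]_s (v (x + c * s)%R * M%:E))%E).
  apply: ge0_le_integral => //.
  - by move=> s _; exact: smear_integrand_ge0.
  - exact: measurable_smear_integrand.
  - by apply: emeasurable_funM.
  - by move=> s _; rewrite lee_wpmul2l ?lee_fin.
rewrite ge0_integralZr//.
rewrite -(@lee_pmul2l _ c%:E)//.
rewrite muleA -ge0_integral_translate_scale// -EFinM.
rewrite [X in (_ <= X%:E)%E](_ : _ = D * M); last by field; rewrite gt_eqF.
by rewrite EFinM lee_wpmul2r// lee_fin.
Qed.

End smearing.

(** * Gaussian smearing and replacement by Gaussians *)

Section gaussian_smearing.
Context {R : realType}.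
Local Notation mu := (@lebesgue_measure R).
Implicit Types (f g : R -> R) (u v w : R -> \bar R) (c B L C e x : R).

Lemma nndens_phi : nndens (@phi R).
Proof. by split; [exact: measurable_phi|exact: phi_ge0]. Qed.

Lemma prob_density_phi : prob_density phi_moment (@phi R).
Proof. by split; [exact: nndens_phi|exact: integral_phi|exact: integral_norm_phi]. Qed.

Lemma smear_phiE c v x : 0 < c -> nnmeas v ->
  smear phi c v x = (\int[mu]_z (v z * (normal_pdf x c z)%:E))%E.
Proof.
move=> c0 [mv v0]; rewrite (ge0_integral_translate_scale x c0); last 2 first.
- apply: emeasurable_funM => //; apply/measurable_EFinP.
  exact: measurable_normal_pdf.
- by move=> y; rewrite mule_ge0// lee_fin normal_pdf_ge0.
rewrite /smear.
rewrite -ge0_integralZl//=; last 3 first.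
- apply: emeasurable_funM.
    by apply: (measurableT_comp mv); exact: measurable_affine.
  apply/measurable_EFinP; apply: (measurableT_comp (measurable_normal_pdf x c)).
  exact: measurable_affine.
- by move=> y _; rewrite mule_ge0// lee_fin normal_pdf_ge0.
- by rewrite lee_fin ltW.
apply: eq_integral => s _; rewrite muleCA -EFinM normal_pdf_phi//; congr (_ * _%:E)%E.
rewrite mulrA divff ?gt_eqF// mul1r; congr phi; field; exact: lt0r_neq0.
Qed.

(** Completing the square in y: the product of two Gaussian kernels is the
    convolved kernel times a Gaussian density in the intermediate point. *)
Lemma normal_pdf_mul (c d x y z : R) : 0 < c -> 0 < d ->
  let s := Num.sqrt (c ^+ 2 + d ^+ 2) in
  normal_pdf y d z * normal_pdf x c y =
  normal_pdf x s z *
  normal_pdf ((x * d ^+ 2 + z * c ^+ 2) / s ^+ 2) (c * d / s) y.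
Proof.
move=> c0 d0 s.
have s20 : 0 < c ^+ 2 + d ^+ 2 by rewrite addr_gt0// exprn_gt0.
have s0 : 0 < s by rewrite sqrtr_gt0.
have sE : s ^+ 2 = c ^+ 2 + d ^+ 2 by rewrite sqr_sqrtr// ltW.
have cd0 : 0 < c * d / s by rewrite divr_gt0// mulr_gt0.
rewrite !normal_pdf_phi//.
rewrite (phiE ((z - y) / d)) (phiE ((y - x) / c)) (phiE ((z - x) / s)).
rewrite (phiE (_ / (c * d / s))).
have merge (p q k l e1 e2 e3 e4 : R) : p * q = k * l -> e1 + e2 = e3 + e4 ->
    p * (phi 0 * expR e1) * (q * (phi 0 * expR e2)) =
    k * (phi 0 * expR e3) * (l * (phi 0 * expR e4)).
  move=> pq ee.
  rewrite [LHS](_ : _ = p * q * (phi 0 ^+ 2) * expR (e1 + e2)); last first.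
    by rewrite expRD; ring.
  by rewrite pq ee expRD; ring.
apply: merge.
  by field; rewrite !gt_eqF.
rewrite !expr_div_n sE; field.
by rewrite !gt_eqF.
Qed.

Lemma smear_phi_comp c d v x : 0 < c -> 0 < d -> nnmeas v ->
  smear phi c (smear phi d v) x = smear phi (Num.sqrt (c ^+ 2 + d ^+ 2)) v x.
Proof.
move=> c0 d0 dv; have [mv v0] := dv; set s := Num.sqrt _.
have s0 : 0 < s by rewrite sqrtr_gt0 addr_gt0// exprn_gt0.
rewrite (smear_phiE x c0 (nnmeas_smear d nndens_phi dv)) (smear_phiE x s0 dv).
have mpdf : measurable_fun [set: R * R] (fun z : R * R => normal_pdf z.1 d z.2).
  have -> : (fun z : R * R => normal_pdf z.1 d z.2) =
      (fun z => d^-1 * phi ((z.2 - z.1) / d)).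
    by apply/funext => z; rewrite normal_pdf_phi.
  apply: measurable_funM => //; apply: (measurableT_comp measurable_phi).
  by apply: measurable_funM => //; apply: measurable_funB.
pose F (z : R * R) :=
  (v z.2 * (normal_pdf z.1 d z.2 * normal_pdf x c z.1)%:E)%E.
have F0 z : (0 <= F z)%E.
  by rewrite mule_ge0// lee_fin mulr_ge0// normal_pdf_ge0.
have mF : measurable_fun setT F.
  apply: emeasurable_funM; first exact: (measurableT_comp mv).
  apply/measurable_EFinP; apply: measurable_funM => //.
  exact: (measurableT_comp (measurable_normal_pdf x c)).
transitivity (\int[mu]_y \int[mu]_z F (y, z))%E.
  apply: eq_integral => y _; rewrite smear_phiE// -ge0_integralZr//=.
  - by apply: eq_integral => z _; rewrite /F/= EFinM muleA.
  - apply: emeasurable_funM => //; apply/measurable_EFinP.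
    exact: measurable_normal_pdf.
  - by move=> z _; rewrite mule_ge0// lee_fin normal_pdf_ge0.
  - by rewrite lee_fin normal_pdf_ge0.
rewrite fubini_tonelli//.
apply: eq_integral => z _; rewrite /F/=.
under eq_integral do rewrite normal_pdf_mul// EFinM muleA.
rewrite -/s ge0_integralZl//=.
- by rewrite integral_normal_pdf mule1.
- by apply/measurable_EFinP; exact: measurable_normal_pdf.
- by move=> y _; rewrite lee_fin normal_pdf_ge0.
- by rewrite mule_ge0// lee_fin normal_pdf_ge0.
Qed.

(** Index 0 is innermost, so that the first density acts on v itself. *)
Fixpoint smears (f : nat -> R -> R) (c : nat -> R) (N : nat) v :=
  if N is n.+1 then smear (f n) (c n) (smears f c n v) else v.

Lemma nnmeas_smears (f : nat -> R -> R) (c : nat -> R) N v :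
  (forall n, nndens (f n)) -> nnmeas v -> nnmeas (smears f c N v).
Proof. by move=> df dv; elim: N => //= N IH; exact: nnmeas_smear. Qed.

Lemma smears_phi (c : nat -> R) N v x : (forall n, 0 < c n) -> nnmeas v ->
  smears (fun=> phi) c N.+1 v x =
  smear phi (Num.sqrt (\sum_(i < N.+1) c i ^+ 2)) v x.
Proof.
move=> c0 dv; elim: N x => [|N IH] x.
  by rewrite big_ord_recl big_ord0 addr0 sqrtr_sqr gtr0_norm.
have -> : smears (fun=> phi) c N.+2 v =
    smear phi (c N.+1) (smears (fun=> phi) c N.+1 v) by [].
rewrite (funext IH) smear_phi_comp//.
  rewrite sqr_sqrtr; last by apply: sumr_ge0 => i _; exact: sqr_ge0.
  by rewrite addrC [in RHS]big_ord_recr.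
rewrite sqrtr_gt0 big_ord_recl ltr_pwDl//; first by rewrite exprn_gt0.
by apply: sumr_ge0 => i _; exact: sqr_ge0.
Qed.

(** Replacement of the densities by Gaussians one at a time. The first step is
    separate because the constants B and L are those of the Gaussian smearing of
    w, not of w, which may be discontinuous. Each later replacement adds its own
    error, and earlier errors are not amplified because smearing contracts. *)
Lemma smears_close (f : nat -> R -> R) (c : nat -> R) C B L (e : nat -> R) w :
  (forall n, prob_density C (f n)) -> 0 <= B -> 0 <= L ->
  nnmeas w -> (forall n, 0 <= e n) ->
  unif_close (e 0%N) (smear (f 0%N) (c 0%N) w) (smear phi (c 0%N) w) ->
  bounded_lip B L (smear phi (c 0%N) w) ->
  (forall n v, bounded_lip B L v ->
    unif_close (e n.+1) (smear (f n.+1) (c n.+1) v) (smear phi (c n.+1) v)) ->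
  forall N, unif_close (\sum_(i < N.+1) e i)
      (smears f c N.+1 w) (smears (fun=> phi) c N.+1 w) /\
    bounded_lip B L (smears (fun=> phi) c N.+1 w).
Proof.
move=> df B0 L0 dw e0 close0 lip0 closeS; elim=> [|N [IHc IHl]].
  by rewrite big_ord_recl big_ord0 addr0.
split; last exact: bounded_lip_smear prob_density_phi _ _ IHl.
have S0 : 0 <= \sum_(i < N.+1) e i by apply: sumr_ge0.
have df' n : nndens (f n) by case: (df n).
have dfw : nnmeas (smears f c N.+1 w) by exact: nnmeas_smears.
have dpw : nnmeas (smears (fun=> phi) c N.+1 w).
  by apply: nnmeas_smears => // _; exact: nndens_phi.
have h1 := smear_close (c N.+1) (df N.+1) dfw dpw S0 IHc.
have h2 := closeS N _ IHl.
move=> x; have [a1 a2] := h1 x; have [b1 b2] := h2 x.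
have -> : \sum_(i < N.+2) e i = \sum_(i < N.+1) e i + e N.+1 by rewrite big_ord_recr.
have smearsS k : smears k c N.+2 w = smear (k N.+1) (c N.+1) (smears k c N.+1 w) by [].
rewrite EFinD !smearsS; split.
- by apply: le_trans a1 _; rewrite [X in (_ <= _ + X)%E]addeC addeA; exact: (leeD2r _ b1).
- by rewrite addeA; apply: le_trans b2 (leeD2r _ a2).
Qed.

(** One more Gaussian step of standard deviation sqrt(1 - s2) completes the
    variance to 1 and moves a Lipschitz function little, so that the limit does
    not depend on the weights. *)
Lemma smears_phi_near_unit (c : nat -> R) N B L w x :
  (forall n, 0 < c n) -> 0 <= L -> nnmeas w ->
  bounded_lip B L (smears (fun=> phi) c N.+1 w) ->
  let s2 := \sum_(i < N.+1) c i ^+ 2 in s2 < 1 ->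
  let d := phi_moment * L * Num.sqrt (1 - s2) + L * `|x| in
  (smears (fun=> phi) c N.+1 w x <= smear phi 1 w 0 + d%:E)%E /\
  (smear phi 1 w 0 <= smears (fun=> phi) c N.+1 w x + d%:E)%E.
Proof.
move=> c0 L0 dw lip s2 s21 d.
set V := smears _ c N.+1 w in lip *.
have s20 : 0 < s2.
  rewrite /s2 big_ord_recl ltr_pwDl//; first by rewrite exprn_gt0.
  by apply: sumr_ge0 => i _; exact: sqr_ge0.
have t0 : 0 < Num.sqrt (1 - s2) by rewrite sqrtr_gt0 subr_gt0.
have J y : smear phi (Num.sqrt (1 - s2)) V y = smear phi 1 w y.
  have -> : V = smear phi (Num.sqrt s2) w.
    by apply/funext => z; exact: smears_phi.
  rewrite smear_phi_comp// ?sqrtr_gt0// !sqr_sqrtr ?(ltW s20) ?subr_ge0 ?(ltW s21)//.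
  by rewrite subrK sqrtr1.
have [k1 k2] := smear_near_id prob_density_phi (ltW t0) L0 lip 0.
rewrite J in k1 k2.
have [_ _ lipV] := lip.
split.
- apply: le_trans (lipV x 0) _; rewrite subr0 /d EFinD addeA; exact: leeD2r.
- apply: le_trans k1 _; rewrite /d (addrC _ (L * `|x|)) EFinD addeA.
  apply: leeD2r; apply: le_trans (lipV 0 x) _.
  by rewrite sub0r normrN.
Qed.

End gaussian_smearing.

Section exponential_kernel.
Context {R : realType}.
Local Notation mu := (@lebesgue_measure R).
Implicit Types (c r x : R).

(** The exponential density of rate r: r times the weight e^(-r x) that the
    tilting leaves on the event x >= 0. *)
Definition expo r x : \bar R := (exponential_pdf r x)%:E.

Lemma nnmeas_expo r : 0 < r -> nnmeas (expo r).
Proof.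
move=> r0; split; first by apply/measurable_EFinP; exact: measurable_exponential_pdf.
by move=> x; rewrite lee_fin exponential_pdf_ge0// ltW.
Qed.

(** The constants do not involve r: expo r has mass 1, and it is the Gaussian
    factor of the convolution that is bounded and Lipschitz. *)
Lemma bounded_lip_smear_expo c r : 0 < c -> 0 < r ->
  bounded_lip (phi 0 / c) (phi 0 / c ^+ 2) (smear phi c (expo r)).
Proof.
move=> c0 r0; have dw := nnmeas_expo r0.
have pd := @nndens_phi R.
have int1 : (\int[mu]_y expo r y = 1)%E by exact: integral_exponential_pdf.
split; first exact: nnmeas_smear.
- move=> x; rewrite -[phi 0 / c]mulr1; apply: smear_le_sup => //.
  + exact: phi_ge0.
  + by rewrite int1.
  + exact: phi_le0.
- move=> x y; rewrite !smear_phiE//.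
  have [mw w0] := dw.
  have K0 : 0 <= phi 0 / c ^+ 2 * `|x - y|.
    by rewrite mulr_ge0// divr_ge0// ?phi_ge0// sqr_ge0.
  have mn a : measurable_fun [set: R] (fun z : R => (normal_pdf a c z)%:E).
    by apply/measurable_EFinP; exact: measurable_normal_pdf.
  rewrite -[X in (_ <= _ + X)%E]mule1 -int1 -ge0_integralZl//.
  rewrite -ge0_integralD//; last 4 first.
  + by move=> z _; rewrite mule_ge0// lee_fin normal_pdf_ge0.
  + by apply: emeasurable_funM; [exact: mw|exact: mn].
  + by move=> z _; rewrite mule_ge0// lee_fin.
  + by apply: emeasurable_funM; [exact: measurable_cst|exact: mw].
  apply: ge0_le_integral => //.
  + by move=> z _; rewrite mule_ge0// lee_fin normal_pdf_ge0.
  + by apply: emeasurable_funM; [exact: mw|exact: mn].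
  + apply: emeasurable_funD; apply: emeasurable_funM;
      by [exact: mw|exact: mn|exact: measurable_cst].
  + move=> z _; rewrite [X in (_ <= _ + X)%E]muleC -ge0_muleDr ?lee_fin ?normal_pdf_ge0//.
    apply: ler_wpM2l; first by rewrite exponential_pdf_ge0 ?ltW.
    rewrite !normal_pdf_phi// -lerBlDl -mulrBr.
    rewrite (_ : phi 0 / c ^+ 2 * `|x - y| = c^-1 * (phi 0 * (`|x - y| / c))); last first.
      by field; rewrite gt_eqF.
    rewrite ler_wpM2l ?invr_ge0 ?(ltW c0)//.
    apply: le_trans (ler_norm _) _; apply: le_trans (phi_lipschitz _ _) _.
    rewrite ler_wpM2l ?phi_ge0// (_ : _ - _ = (y - x) / c); last by ring.
    by rewrite normrM distrC (gtr0_norm (_ : 0 < c^-1))// invr_gt0.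
Qed.

(** On the interval from 0 to 1/r the exponential density is at least r/e and
    phi is at least phi 1. *)
Lemma smear_expo_ge r : 1 <= r ->
  ((expR (-1) * phi 1)%:E <= smear phi 1 (expo r) 0)%E.
Proof.
move=> r1; have r0 : 0 < r by exact: lt_le_trans r1.
have [mw w0] := nnmeas_expo r0.
apply: (@le_trans _ _ (\int[mu]_(s in `[0%R, (r^-1)%R])
    ((r * expR (-1) * phi 1)%:E))%E).
  have muE : mu `[0, r^-1]%classic = (r^-1)%:E.
    by rewrite lebesgue_measure_itv/= lte_fin invr_gt0 r0 sube0.
  rewrite integral_cst// [X in (_ * X)%E]muE -EFinM lee_fin.
  rewrite le_eqVlt; apply/orP; left; apply/eqP.
  by field; rewrite gt_eqF.
apply: (@le_trans _ _ (\int[mu]_(s in `[0%R, (r^-1)%R])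
    (expo r (0 + 1 * s)%R * (phi s)%:E))%E); last first.
  apply: ge0_subset_integral => //.
  - exact: measurable_smear_integrand nndens_phi (nnmeas_expo r0).
  - by move=> s _; exact: smear_integrand_ge0 nndens_phi (nnmeas_expo r0).
apply: ge0_le_integral => //.
- by move=> s _; rewrite lee_fin !mulr_ge0 ?expR_ge0 ?phi_ge0// ltW.
- apply: measurable_funTS.
  exact: measurable_smear_integrand nndens_phi (nnmeas_expo r0).
- move=> s /=; rewrite in_itv/= => /andP[s0 sr].
  rewrite add0r mul1r /expo -EFinM lee_fin exponential_pdfE//.
  rewrite ler_pM ?mulr_ge0 ?expR_ge0 ?phi_ge0 ?(ltW r0)//.
  + rewrite ler_wpM2l ?(ltW r0)// ler_expR mulNr lerN2.
    by rewrite -(divff (lt0r_neq0 r0)) ler_wpM2l// ltW.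
  + apply: phi_anti; rewrite s0/=; apply: le_trans sr _.
    by rewrite invf_le1.
Qed.

End exponential_kernel.

(** * The tilted folded Gaussian density *)

Section gaussian_cdf.
Context {R : realType}.
Local Notation mu := (@lebesgue_measure R).
Implicit Types (a b x : R).

Definition Phi x : R := (\int[mu]_(s in `]-oo, x]) phi s)%R.

Lemma integrable_phi : mu.-integrable [set: R] (EFin \o (@phi R)).
Proof. exact: integrable_normal_pdf. Qed.

Lemma PhiE x : (Phi x)%:E = (\int[mu]_(s in `]-oo, x]) (phi s)%:E)%E.
Proof.
rewrite /Phi /Rintegral fineK//; apply: integrable_fin_num => //.
exact: integrableS integrable_phi.
Qed.

Lemma Phi_ge0 x : 0 <= Phi x.
Proof. by apply: Rintegral_ge0 => s _; exact: phi_ge0. Qed.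

Lemma Phi_le1 x : Phi x <= 1.
Proof.
rewrite -lee_fin PhiE -integral_phi; apply: ge0_subset_integral => //.
- by apply/measurable_EFinP; exact: measurable_phi.
- by move=> s _; rewrite lee_fin phi_ge0.
Qed.

Lemma Phi_ge_phi1 x : 0 <= x -> phi 1 <= Phi x.
Proof.
move=> x0; rewrite -lee_fin PhiE.
have sub : (`[(-1)%R, 0%R]%classic : set R) `<=` `]-oo, x]%classic.
  by move=> s /=; rewrite !in_itv/= => /andP[_ s0]; exact: le_trans x0.
apply: (@le_trans _ _ (\int[mu]_(s in `[(-1)%R, 0%R]) (phi s)%:E)%E); last first.
  apply: ge0_subset_integral => //.
  - by apply/measurable_EFinP/measurable_funTS; exact: measurable_phi.
  - by move=> s _; rewrite lee_fin phi_ge0.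
have muE : mu `[-1, 0]%classic = 1%:E.
  by rewrite lebesgue_measure_itv/= lte_fin ltrN10 add0e opprK.
rewrite -[X in (X <= _)%E]mule1 -{1}muE -integral_cst//.
apply: ge0_le_integral => //.
- by move=> s _; rewrite lee_fin phi_ge0.
- by apply/measurable_EFinP/measurable_funTS; exact: measurable_phi.
- move=> s /=; rewrite in_itv/= lee_fin -(phiN s) => /andP[s1 s0].
  by apply: phi_anti; rewrite oppr_ge0 s0 lerNl.
Qed.

Lemma is_derive_Phi x : is_derive x (1 : R) Phi (phi x).
Proof.
have xx1 : x < x + 1 by rewrite ltrDl.
have int : mu.-integrable `]-oo, x + 1] (EFin \o (@phi R)).
  exact: integrableS integrable_phi.
have [dF F'] := continuous_FTC1 xx1 int (ltNyr x) (@continuous_phi R x).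
by apply: DeriveDef; [exact: dF|rewrite -derive1E; exact: F'].
Qed.

Definition cut_phi a b (s : R) : R := if - a <= s then phi (s + b) else 0.

Lemma nndens_phi_shift b : nndens (fun s : R => phi (s + b)).
Proof.
split=> [|s]; last exact: phi_ge0.
by apply: (measurableT_comp measurable_phi); exact: measurable_funD.
Qed.

Lemma nndens_cut_phi a b : nndens (cut_phi a b).
Proof.
split=> [|s]; last by rewrite /cut_phi; case: ifP => _; rewrite ?phi_ge0.
apply: measurable_fun_if => //.
- by apply: measurable_fun_ler.
- by apply: measurable_funTS; case: (nndens_phi_shift b).
Qed.

Lemma integral_cut_phi a b : (\int[mu]_s (cut_phi a b s)%:E = (Phi (a - b))%:E)%E.
Proof.
have [mc c0] := nndens_cut_phi a b.
have mcE : measurable_fun [set: R] (EFin \o cut_phi a b) by exact/measurable_EFinP.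
rewrite -(ge0_integral_reflect mcE); last by move=> y; rewrite lee_fin.
rewrite (ge0_integral_translate_scale b ltr01)//; first last.
- by move=> y; rewrite lee_fin.
- by apply: (measurableT_comp mcE).
rewrite mul1e PhiE [RHS]integral_mkcond; apply: eq_integral => s _ /=.
rewrite patchE mul1r /cut_phi lerN2 mem_setE in_itv/= lerBrDl.
by case: ifP => // _; rewrite -(phiN s); congr (phi _)%:E; ring.
Qed.

End gaussian_cdf.

Section folded_kernel.
Context {R : realType}.
Local Notation mu := (@lebesgue_measure R).
Implicit Types (m t s x : R).

(** Let X be |N(m,1)| - m. Tilting its law by e^(t x) and recentring at t gives
    the density phi * fold_factor m t up to the constant fold_mass m t: the 1
    comes from the positive half-line, the exponential from the folded negative
    one. *)
Definition fold_factor m t s : R :=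
  if - (m + t) <= s then 1 + expR (- (2 * m * (s + m + t))) else 0.

Definition fold_mass m t : R :=
  Phi (t + m) + expR (- (2 * m * t)) * Phi (t - m).

Definition fold_density m t s : R := phi s * fold_factor m t s / fold_mass m t.

Lemma phi_fold_factorE m t s : phi s * fold_factor m t s =
  cut_phi (m + t) 0 s + expR (- (2 * m * t)) * cut_phi (m + t) (2 * m) s.
Proof.
rewrite /fold_factor /cut_phi; case: ifP => _; last by rewrite !mulr0 addr0.
rewrite addr0 mulrDr mulr1 phiD; congr (_ + _).
by rewrite mulrCA -expRD; congr (_ * expR _); field.
Qed.

Lemma fold_factor_ge0 m t s : 0 <= fold_factor m t s.
Proof. by rewrite /fold_factor; case: ifP => // _; rewrite addr_ge0// expR_ge0. Qed.

Lemma fold_factor_le2 m t s : 0 <= m -> fold_factor m t s <= 2.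
Proof.
move=> m0; rewrite /fold_factor; case: ifP => // h; rewrite -[2]/(1 + 1).
rewrite lerD2l -[leRHS]expR0 ler_expR oppr_le0 !mulr_ge0//; lra.
Qed.

Lemma measurable_phi_fold_factor m t :
  measurable_fun [set: R] (fun s => phi s * fold_factor m t s).
Proof.
rewrite (funext (phi_fold_factorE m t)); apply: measurable_funD.
  by case: (nndens_cut_phi (m + t) 0).
by apply: measurable_funM => //; case: (nndens_cut_phi (m + t) (2 * m)).
Qed.

Lemma nndens_phi_fold_factor m t : nndens (fun s => phi s * fold_factor m t s).
Proof.
split=> [|s]; first exact: measurable_phi_fold_factor.
by rewrite mulr_ge0 ?phi_ge0 ?fold_factor_ge0.
Qed.

Lemma integral_phi_fold_factor m t :
  (\int[mu]_s (phi s * fold_factor m t s)%:E = (fold_mass m t)%:E)%E.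
Proof.
under eq_integral do rewrite phi_fold_factorE EFinD EFinM.
have [m1 p1] := nndens_cut_phi (m + t) 0.
have [m2 p2] := nndens_cut_phi (m + t) (2 * m).
rewrite ge0_integralD//=; last 4 first.
- by move=> s _; rewrite lee_fin.
- exact/measurable_EFinP.
- by move=> s _; rewrite mule_ge0// lee_fin ?expR_ge0.
- by apply: emeasurable_funM => //; exact/measurable_EFinP.
rewrite ge0_integralZl//=; last 2 first.
- exact/measurable_EFinP.
- by move=> s _; rewrite lee_fin.
rewrite !integral_cut_phi -EFinM -EFinD /fold_mass; congr (Phi _ + _ * Phi _)%:E; ring.
Qed.

Lemma fold_mass_ge m t : 0 <= m -> 0 <= t -> phi 1 <= fold_mass m t.
Proof.
move=> m0 t0; rewrite -[leLHS]addr0 lerD// ?Phi_ge_phi1 ?addr_ge0//.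
by rewrite mulr_ge0 ?expR_ge0 ?Phi_ge0.
Qed.

Lemma fold_mass_gt0 m t : 0 <= m -> 0 <= t -> 0 < fold_mass m t.
Proof. by move=> m0 t0; apply: lt_le_trans (fold_mass_ge m0 t0); exact: phi_gt0. Qed.

Lemma prob_density_fold m t : 0 <= m -> 0 <= t ->
  prob_density (2 * phi_moment / phi 1) (fold_density m t).
Proof.
move=> m0 t0; have h0 := fold_mass_gt0 m0 t0; have h1 := fold_mass_ge m0 t0.
have [mk k0] := nndens_phi_fold_factor m t.
have df : nndens (fold_density m t).
  split; first by apply: measurable_funM.
  by move=> s; rewrite divr_ge0// ltW.
split => //.
- under eq_integral do rewrite /fold_density mulrC EFinM.
  rewrite ge0_integralZl//=.
  + by rewrite integral_phi_fold_factor -EFinM mulVf// gt_eqF.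
  + exact/measurable_EFinP.
  + by move=> s _; rewrite lee_fin.
  + by rewrite lee_fin invr_ge0 ltW.
- apply: (@le_trans _ _ (\int[mu]_s ((2 / phi 1)%:E * (`|s| * phi s)%:E))%E).
    have c0 : 0 <= 2 / phi 1 :> R by rewrite divr_ge0// phi_ge0.
    apply: ge0_le_integral => //.
    + by move=> s _; rewrite lee_fin mulr_ge0//; case: df.
    + apply/measurable_EFinP; apply: measurable_funM; last by case: df.
      exact: normr_measurable.
    + apply: emeasurable_funM => //; apply/measurable_EFinP.
      apply: measurable_funM; [exact: normr_measurable|exact: measurable_phi].
    + move=> s _; rewrite -EFinM lee_fin [leRHS]mulrCA ler_wpM2l//.
      rewrite /fold_density (_ : 2 / phi 1 * phi s = phi s * 2 / phi 1); last by ring.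
      rewrite ler_pM ?invr_ge0 ?(ltW h0)//.
      * by rewrite ler_wpM2l ?phi_ge0// fold_factor_le2.
      * by rewrite lef_pV2 ?posrE ?phi_gt0.
  rewrite ge0_integralZl//=; last 3 first.
  - apply/measurable_EFinP.
    apply: measurable_funM; [exact: normr_measurable|exact: measurable_phi].
  - by move=> s _; rewrite lee_fin mulr_ge0// phi_ge0.
  - by rewrite lee_fin divr_ge0// phi_ge0.
  rewrite (_ : 2 * phi_moment / phi 1 = 2 / phi 1 * phi_moment); last by ring.
  rewrite (EFinM (2 / phi 1)) lee_wpmul2l// ?integral_norm_phi//.
  by rewrite lee_fin divr_ge0// phi_ge0.
Qed.

(** The limit of fold_mass m t and of fold_factor m t s as t grows. For m = 0
    the folded half-line keeps the same weight as the other one. *)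
Definition fold_limit m : R := if m == 0 then 2 else 1.

Definition fold_err m t : R :=
  2 * expR (- (t ^+ 2 / 2)) + (if m == 0 then 0 else expR (- (2 * m * t))).

Lemma fold_err_ge0 m t : 0 <= fold_err m t.
Proof.
by rewrite addr_ge0// ?mulr_ge0 ?expR_ge0//; case: ifP => // _; exact: expR_ge0.
Qed.

(** Left of the cut, phi s is small since s is at distance at least t + m from
    0. Right of it the error is the folded term, a Gaussian translate times
    e^(-2 m t), which is absent from the error when m = 0. Bounding by Gaussian
    translates makes the error small both in mass and in supremum. *)
Lemma fold_factor_close m t s : 0 <= m -> 0 <= t ->
  `|phi s * fold_factor m t s - fold_limit m * phi s| <=
  fold_err m t * (phi (s + (t + m)) + phi (s + 2 * m)).
Proof.
move=> m0 t0.
have p1 := phi_ge0 (s + (t + m)); have p2 := phi_ge0 (s + 2 * m).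
have e1 := expR_ge0 (- (t ^+ 2 / 2)).
set E2 := if m == 0 then 0 else expR (- (2 * m * t)).
have E20 : 0 <= E2 by rewrite /E2; case: ifP => // _; exact: expR_ge0.
rewrite /fold_factor; case: ifPn => h.
- apply: (@le_trans _ _ (E2 * phi (s + 2 * m))); last first.
    rewrite /fold_err -/E2; nra.
  rewrite /E2 /fold_limit; case: ifPn => [/eqP ->|mn0].
    rewrite !mulr0 !mul0r oppr0 expR0 mulrC subrr normr0//.
  rewrite mulrDr mulr1 mul1r addrAC subrr add0r ger0_norm ?mulr_ge0 ?phi_ge0 ?expR_ge0//.
  rewrite phiD mulrCA -expRD le_eqVlt; apply/orP; left; apply/eqP.
  by congr (_ * expR _); field.
- rewrite mulr0 sub0r normrN ger0_norm; last first.
    by rewrite mulr_ge0 ?phi_ge0// /fold_limit; case: ifP.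
  apply: (@le_trans _ _ (2 * expR (- (t ^+ 2 / 2)) * phi (s + (t + m)))); last first.
    rewrite /fold_err -/E2; nra.
  have -> : phi s = phi (s + (t + m)) * expR ((t + m) * (s + (t + m)) - (t + m) ^+ 2 / 2).
    rewrite (_ : phi s = phi (s + (t + m) + - (t + m))); last by rewrite addrK.
    by rewrite phiD; congr (_ * expR _); ring.
  rewrite -[leRHS]mulrA ler_pM//.
  + by rewrite /fold_limit; case: ifP.
  + by rewrite mulr_ge0 ?phi_ge0 ?expR_ge0.
  + by rewrite /fold_limit; case: ifP => _; lra.
  + rewrite mulrC ler_wpM2r// ler_expR.
    move: h; rewrite -ltNge => h.
    have : (t + m) * (s + (t + m)) <= 0.
      by rewrite mulr_ge0_le0 ?addr_ge0//; lra.
    have : t ^+ 2 <= (t + m) ^+ 2 by rewrite ler_pXn2r ?nnegrE ?addr_ge0//; lra.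
    by lra.
Qed.

Lemma phi_pair_integral (e x y : R) : 0 <= e ->
  (\int[mu]_s (e * (phi (s + x) + phi (s + y)))%:E = (2 * e)%:E)%E.
Proof.
move=> e0.
under eq_integral do rewrite EFinM EFinD.
rewrite ge0_integralZl//=; last 2 first.
- apply: emeasurable_funD; apply/measurable_EFinP.
    by case: (nndens_phi_shift x).
  by case: (nndens_phi_shift y).
- by move=> s _; rewrite adde_ge0// lee_fin phi_ge0.
rewrite ge0_integralD//=; last 4 first.
- by move=> s _; rewrite lee_fin phi_ge0.
- by apply/measurable_EFinP; case: (nndens_phi_shift x).
- by move=> s _; rewrite lee_fin phi_ge0.
- by apply/measurable_EFinP; case: (nndens_phi_shift y).
by rewrite !integral_phi_shift -EFinD -EFinM; congr EFin; ring.
Qed.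

Lemma nndens_phi_pair (e x y : R) : 0 <= e ->
  nndens (fun s => e * (phi (s + x) + phi (s + y))).
Proof.
move=> e0; split=> [|s]; last by rewrite mulr_ge0// addr_ge0// phi_ge0.
apply: measurable_funM => //; apply: measurable_funD.
  by case: (nndens_phi_shift x).
by case: (nndens_phi_shift y).
Qed.

Lemma fold_mass_close m t : 0 <= m -> 0 <= t ->
  `|fold_mass m t - fold_limit m| <= 2 * fold_err m t.
Proof.
move=> m0 t0; have eps0 := fold_err_ge0 m t.
have l0 : 0 <= fold_limit m by rewrite /fold_limit; case: ifP.
set psi := fun s => fold_err m t * (phi (s + (t + m)) + phi (s + 2 * m)).
have [mk k0] := nndens_phi_fold_factor m t.
have [mpsi psi0] : nndens psi by exact: nndens_phi_pair.
have lE : (\int[mu]_s (fold_limit m * phi s)%:E = (fold_limit m)%:E)%E.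
  under eq_integral do rewrite EFinM.
  rewrite ge0_integralZl//=.
  - by rewrite integral_phi mule1.
  - by apply/measurable_EFinP; exact: measurable_phi.
  - by move=> s _; rewrite lee_fin phi_ge0.
have mlp : measurable_fun [set: R] (fun s => fold_limit m * phi s).
  by apply: measurable_funM => //; exact: measurable_phi.
have lp0 s : 0 <= fold_limit m * phi s by rewrite mulr_ge0 ?phi_ge0.
have cl s := fold_factor_close s m0 t0.
rewrite ler_distlC; apply/andP; split.
- rewrite lerBlDr -lee_fin (EFinD (fold_limit m)) -lE -(phi_pair_integral (t + m) (2 * m) eps0).
  rewrite -integral_phi_fold_factor -ge0_integralD//=; last 4 first.
  + by move=> s _; rewrite lee_fin.
  + exact/measurable_EFinP.
  + by move=> s _; rewrite lee_fin; exact: psi0.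
  + by apply/measurable_EFinP.
  apply: ge0_le_integral => //=.
  + by move=> s _; rewrite lee_fin.
  + exact/measurable_EFinP.
  + by apply: emeasurable_funD; exact/measurable_EFinP.
  + by move=> s _; rewrite -EFinD lee_fin; have := cl s; rewrite ler_distlC; lra.
- rewrite -lee_fin (EFinD (fold_mass m t)) -lE -(phi_pair_integral (t + m) (2 * m) eps0).
  rewrite -integral_phi_fold_factor -ge0_integralD//=; last 4 first.
  + by move=> s _; rewrite lee_fin.
  + exact/measurable_EFinP.
  + by move=> s _; rewrite lee_fin; exact: psi0.
  + by apply/measurable_EFinP.
  apply: ge0_le_integral => //=.
  + by move=> s _; rewrite lee_fin.
  + exact/measurable_EFinP.
  + by apply: emeasurable_funD; exact/measurable_EFinP.
  + by move=> s _; rewrite -EFinD lee_fin; have := cl s; rewrite ler_distlC; lra.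
Qed.

(** The error of fold_factor_close divided by a lower bound of the mass, plus
    the error caused by the normalization; the translations by 0 give the second
    term the shape of the first. *)
Definition fold_gap m t s : R :=
  fold_err m t / phi 1 * (phi (s + (t + m)) + phi (s + 2 * m)) +
  fold_err m t / phi 1 * (phi (s + 0) + phi (s + 0)).

Lemma nndens_fold_gap m t : nndens (fold_gap m t).
Proof.
have e0 : 0 <= fold_err m t / phi 1 by rewrite divr_ge0 ?fold_err_ge0 ?phi_ge0.
have [m1 p1] := nndens_phi_pair (t + m) (2 * m) e0.
have [m2 p2] := nndens_phi_pair 0 0 e0.
by split=> [|s]; [exact: measurable_funD|exact: addr_ge0].
Qed.

Lemma integral_fold_gap m t :
  (\int[mu]_s (fold_gap m t s)%:E = (4 / phi 1 * fold_err m t)%:E)%E.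
Proof.
have e0 : 0 <= fold_err m t / phi 1 by rewrite divr_ge0 ?fold_err_ge0 ?phi_ge0.
have [m1 p1] := nndens_phi_pair (t + m) (2 * m) e0.
have [m2 p2] := nndens_phi_pair 0 0 e0.
under eq_integral do rewrite EFinD.
rewrite ge0_integralD//=; last 4 first.
- by move=> s _; rewrite lee_fin; exact: p1.
- exact/measurable_EFinP.
- by move=> s _; rewrite lee_fin; exact: p2.
- exact/measurable_EFinP.
by rewrite !phi_pair_integral// -EFinD; congr EFin; ring.
Qed.

Lemma fold_gap_le m t s : fold_gap m t s <= 4 * phi 0 / phi 1 * fold_err m t.
Proof.
have e0 : 0 <= fold_err m t / phi 1 by rewrite divr_ge0 ?fold_err_ge0 ?phi_ge0.
rewrite /fold_gap -mulrDr.
rewrite (_ : 4 * phi 0 / phi 1 * fold_err m t = fold_err m t / phi 1 * (4 * phi 0)); last by ring.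
rewrite ler_wpM2l//.
have := phi_le0 (s + (t + m)); have := phi_le0 (s + 2 * m).
by have := phi_le0 (s + 0); lra.
Qed.

Lemma fold_density_close m t s : 0 <= m -> 0 <= t ->
  `|fold_density m t s - phi s| <= fold_gap m t s.
Proof.
move=> m0 t0; have h0 := fold_mass_gt0 m0 t0; have h1 := fold_mass_ge m0 t0.
have cl := fold_factor_close s m0 t0; have cm := fold_mass_close m0 t0.
have ps := phi_ge0 s.
rewrite /fold_density (_ : _ - _ =
  ((phi s * fold_factor m t s - fold_limit m * phi s) -
   (fold_mass m t - fold_limit m) * phi s) / fold_mass m t); last first.
  by field; rewrite gt_eqF.
rewrite normrM [X in _ * X]ger0_norm ?invr_ge0 ?(ltW h0)//.
apply: (@le_trans _ _ ((fold_err m t * (phi (s + (t + m)) + phi (s + 2 * m)) +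
   2 * fold_err m t * phi s) / phi 1)); last first.
  by rewrite /fold_gap addr0 le_eqVlt; apply/orP; left; apply/eqP; ring.
apply: ler_pM => //; first by rewrite invr_ge0 ltW.
- apply: le_trans (ler_normB _ _) _; apply: lerD => //.
  by rewrite normrM (ger0_norm ps) ler_wpM2r.
- by rewrite lef_pV2 ?posrE ?phi_gt0.
Qed.

End folded_kernel.

(** * The law of the standardized absolute value *)

Section folded_normal_law.
Context {R : realType}.
Local Notation mu := (@lebesgue_measure R).
Implicit Types (v : R -> \bar R) (m s : R).

Lemma measurable_norm_affine (k m : R) :
  measurable_fun [set: R] (fun s : R => `|s| * k - m).
Proof. by apply: measurable_funB => //; exact: measurable_funM. Qed.

Lemma measurable_norm_sub (m : R) : measurable_fun [set: R] (fun s : R => `|s| - m).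
Proof. by apply: measurable_funB. Qed.

(** The sign of the mean is invisible to functions of the absolute value. *)
Lemma integral_even_gaussian v (a m : R) : nnmeas v -> `|a| = m ->
  (\int[mu]_s (v (`|s| - m)%R * (phi (s - a))%:E) =
   \int[mu]_s (v (`|s| - m)%R * (phi (s - m))%:E))%E.
Proof.
move=> [mv v0] <-; case: (ler0P a) => _; last by [].
pose W s := (v (`|s| - - a)%R * (phi (s - a))%:E)%E.
have W0 s : (0 <= W s)%E by rewrite mule_ge0// lee_fin phi_ge0.
have mW : measurable_fun [set: R] W.
  apply: emeasurable_funM.
    exact: (measurableT_comp mv (measurable_norm_sub _)).
  by apply/measurable_EFinP; case: (nndens_phi_shift (- a)).
rewrite -[LHS](ge0_integral_reflect mW W0).
apply: eq_integral => s _; rewrite /W normrN -(phiN (- s - a)).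
by congr (_ * (phi _)%:E)%E; ring.
Qed.

Lemma ge0_integral_fold (W : R -> \bar R) : measurable_fun [set: R] W ->
  (forall s, 0 <= W s)%E ->
  (\int[mu]_s W s = \int[mu]_(s in `[0%R, +oo[) (W s + W (- s)%R))%E.
Proof.
move=> mW W0.
have mWN : measurable_fun [set: R] (fun s => W (- s)).
  by apply: (measurableT_comp mW).
have mW' : measurable_fun [set: R] (W \_ `]-oo, 0%R[).
  by apply/measurable_restrict => //; exact: measurable_funTS.
have W'0 s : (0 <= (W \_ `]-oo, 0%R[) s)%E by rewrite patchE; case: ifP.
have Wneg : (\int[mu]_(s in `]-oo, 0%R[) W s = \int[mu]_(s in `[0%R, +oo[) W (- s)%R)%E.
  rewrite integral_mkcond -(ge0_integral_reflect mW' W'0).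
  rewrite -integral_itv_obnd_cbnd; last exact: measurable_funTS.
  rewrite [RHS]integral_mkcond; apply: eq_integral => s _.
  by rewrite !patchE !mem_setE !in_itv/= andbT oppr_lt0.
have cov : (`[0%R, +oo[%classic : set R) `|` `]-oo, 0%R[%classic = setT.
  apply/seteqP; split => s //= _; rewrite !in_itv/= andbT.
  by case: (leP 0 s) => _; [left|right].
rewrite ge0_integralD//; [|exact: measurable_funTS..].
rewrite -Wneg -ge0_integral_setU//; first by rewrite cov.
  exact: measurable_funTS.
apply/disj_setPRL => s/=; rewrite !in_itv/= andbT => s0 /=.
by apply/negP; rewrite -ltNge.
Qed.

Lemma integral_folded_gaussian v m : nnmeas v -> 0 <= m ->
  (\int[mu]_s (v (`|s| - m)%R * (phi (s - m))%:E) =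
   \int[mu]_y (v y * (phi y * fold_factor m 0 y)%:E))%E.
Proof.
move=> [mv v0] m0.
pose W s := (v (`|s| - m)%R * (phi (s - m))%:E)%E.
have W0 s : (0 <= W s)%E by rewrite mule_ge0// lee_fin phi_ge0.
have mW : measurable_fun [set: R] W.
  apply: emeasurable_funM.
    exact: (measurableT_comp mv (measurable_norm_sub _)).
  by apply/measurable_EFinP; case: (nndens_phi_shift (- m)).
rewrite [LHS](ge0_integral_fold mW W0).
rewrite integral_mkcond (ge0_integral_translate_scale (- m) ltr01); last 2 first.
- apply: emeasurable_funM => //; apply/measurable_EFinP.
  exact: measurable_phi_fold_factor.
- by move=> y; rewrite mule_ge0// lee_fin mulr_ge0 ?phi_ge0 ?fold_factor_ge0.
rewrite mul1e; apply: eq_integral => s _.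
rewrite patchE mem_setE in_itv/= andbT mul1r phi_fold_factorE /cut_phi.
rewrite addr0 lerDl; case: ifPn => s0; last first.
  by rewrite mulr0 addr0 mule0.
rewrite /W normrN ger0_norm// [(- m + s)%R]addrC -ge0_muleDr ?lee_fin ?phi_ge0//.
rewrite -EFinD; congr (_ * (_ + _)%:E)%E; first by rewrite addr0.
rewrite mulr0 oppr0 expR0 mul1r -phiN; congr phi; ring.
Qed.

Lemma integral_folded_normal (alpha beta : R) v : 0 < beta -> nnmeas v ->
  let m := `|alpha| / beta in
  (\int[mu]_z (v (`|z| / beta - m)%R * (normal_pdf alpha beta z)%:E) =
   \int[mu]_y (v y * (phi y * fold_factor m 0 y)%:E))%E.
Proof.
move=> b0 dv m; have [mv v0] := dv.
have m0 : 0 <= m by rewrite divr_ge0// ltW.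
have aE : `|alpha / beta| = m.
  by rewrite normrM [X in _ * X]gtr0_norm ?invr_gt0.
rewrite -(integral_folded_gaussian dv m0) -(integral_even_gaussian dv aE).
rewrite (ge0_integral_translate_scale 0 b0); last 2 first.
- apply: emeasurable_funM.
    exact: (measurableT_comp mv (measurable_norm_affine _ _)).
  by apply/measurable_EFinP; exact: measurable_normal_pdf.
- by move=> y; rewrite mule_ge0// lee_fin normal_pdf_ge0.
rewrite -ge0_integralZl//=; last 3 first.
- apply: emeasurable_funM.
    apply: (measurableT_comp mv).
    exact: (measurableT_comp (measurable_norm_affine _ _) (measurable_affine _ _)).
  apply/measurable_EFinP.
  by apply: (measurableT_comp (measurable_normal_pdf alpha beta)); exact: measurable_affine.
- by move=> y _; rewrite mule_ge0// lee_fin normal_pdf_ge0.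
- by rewrite lee_fin ltW.
apply: eq_integral => s _; rewrite add0r muleCA normal_pdf_phi// -EFinM.
congr (v _ * _%:E)%E.
- by rewrite normrM (gtr0_norm b0); field; exact: lt0r_neq0.
- rewrite mulrA divff ?gt_eqF// mul1r; congr phi; field; exact: lt0r_neq0.
Qed.

(** At t = 0 there is no tilting, and the mass is that of a probability law. *)
Lemma fold_mass0 m : 0 <= m -> fold_mass m 0 = 1.
Proof.
move=> m0.
have E := @integral_folded_normal m 1 (cst 1%:E) ltr01 (nnmeas_cst ler01).
apply: EFin_inj; rewrite -integral_phi_fold_factor.
rewrite -[RHS](integral_normal_pdf m 1).
move: E => /=; rewrite ger0_norm// divr1.
under eq_integral do rewrite mul1e.
move=> ->; apply: eq_integral => s _; by rewrite mul1e.
Qed.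

End folded_normal_law.

(** * Exponential tilting *)

Section tilting.
Context {R : realType}.
Local Notation mu := (@lebesgue_measure R).
Implicit Types (v : R -> \bar R) (m c th x : R).

Definition folded m s : R := phi s * fold_factor m 0 s.

(** Substituting s + th c for the integration variable absorbs the exponential
    into the Gaussian, at the cost of the factor e^(th^2 c^2 / 2) and of a
    displacement of the point by th c^2. *)
Lemma smear_tilt m c th v x : 0 <= m -> 0 <= c -> 0 <= th -> nnmeas v ->
  smear (folded m) c (fun y => (expR (th * y))%:E * v y)%E x =
  ((expR (th * x + th ^+ 2 * c ^+ 2 / 2) * fold_mass m (th * c))%:E *
   smear (fold_density m (th * c)) c v (x + th * c ^+ 2)%R)%E.
Proof.
move=> m0 c0 th0 dv; have [mv v0] := dv.
have t0 : 0 <= th * c by exact: mulr_ge0.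
have h0 := fold_mass_gt0 m0 t0.
have [df _ _] := prob_density_fold m0 t0.
have dq := nndens_phi_fold_factor m 0.
have dev : nnmeas (fun y => (expR (th * y))%:E * v y)%E.
  split=> [|y]; last by rewrite mule_ge0// lee_fin expR_ge0.
  apply: emeasurable_funM => //; apply/measurable_EFinP.
  by apply: measurableT_comp => //; exact: measurable_funM.
have mE := measurable_smear_integrand c x dq dev.
have mD := measurable_smear_integrand c (x + th * c ^+ 2) df dv.
rewrite /smear (ge0_integral_translate_scale (th * c) ltr01 mE); last first.
  by move=> y; exact: (smear_integrand_ge0 c x y dq dev).
rewrite mul1e -ge0_integralZl//=; last 2 first.
- by move=> y _; exact: (smear_integrand_ge0 c _ y df dv).
- by rewrite lee_fin mulr_ge0 ?expR_ge0// ltW.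
apply: eq_integral => s _; rewrite mul1r.
rewrite (_ : x + c * (th * c + s) = x + th * c ^+ 2 + c * s); last by ring.
rewrite -[in LHS]muleA muleCA [RHS]muleCA -!EFinM; congr (_ * _%:E)%E.
rewrite /folded /fold_density [th * c + s]addrC phiD.
have -> : fold_factor m 0 (s + th * c) = fold_factor m (th * c) s.
  rewrite /fold_factor !addr0 opprD lerBlDr.
  by case: ifP => // _; rewrite addrAC.
rewrite [RHS](_ : _ = phi s * fold_factor m (th * c) s *
  expR (th * x + th ^+ 2 * c ^+ 2 / 2)); last by field; rewrite gt_eqF.
have AC (e1 p e2 k : R) : e1 * (p * e2 * k) = p * k * (e1 * e2) by ring.
by rewrite AC -expRD; congr (_ * expR _); field.
Qed.

Lemma smears_tilt m (c : nat -> R) th v N x :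
  0 <= m -> (forall n, 0 <= c n) -> 0 <= th -> nnmeas v ->
  smears (fun=> folded m) c N (fun y => (expR (th * y))%:E * v y)%E x =
  ((expR (th * x + th ^+ 2 * (\sum_(i < N) c i ^+ 2) / 2) *
      \prod_(i < N) fold_mass m (th * c i))%:E *
   smears (fun n => fold_density m (th * c n)) c N v
     (x + th * \sum_(i < N) c i ^+ 2)%R)%E.
Proof.
move=> m0 c0 th0 dv; elim: N x => [|N IH] x.
  by rewrite !big_ord0 !mulr0 mul0r !addr0 mulr1.
pose S := \sum_(i < N) c i ^+ 2.
pose K := expR (th ^+ 2 * S / 2) * \prod_(i < N) fold_mass m (th * c i).
pose V := smears (fun n => fold_density m (th * c n)) c N v.
have dV : nnmeas V.
  apply: nnmeas_smears => // n.
  by case: (prob_density_fold m0 (mulr_ge0 th0 (c0 n))).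
have dVS : nnmeas (fun y => V (y + th * S)).
  case: dV => mV V0; split=> //; apply: (measurableT_comp mV).
  exact: measurable_funD.
have K0 : 0 <= K.
  rewrite mulr_ge0 ?expR_ge0// prodr_ge0// => i _.
  by rewrite ltW// fold_mass_gt0// mulr_ge0.
have dKVS : nnmeas (fun y => K%:E * V (y + th * S)%R)%E.
  case: dVS => mV V0; split=> [|y]; last by rewrite mule_ge0.
  by apply: emeasurable_funM.
set F := fun y => ((expR (th * y))%:E * v y)%E.
have E : smears (fun=> folded m) c N F =
    (fun y => (expR (th * y))%:E * (K%:E * V (y + th * S)%R))%E.
  apply/funext => y; rewrite IH -/S -/V /K muleA -EFinM.
  by congr ((_)%:E * _)%E; rewrite expRD mulrA.
have -> : smears (fun=> folded m) c N.+1 F x =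
  smear (folded m) (c N) (smears (fun=> folded m) c N F) x by [].
rewrite E.
rewrite smear_tilt// !big_ord_recr/= -/S.
have [df _ _] := prob_density_fold m0 (mulr_ge0 th0 (c0 N)).
have dfS := smear_shift (fold_density m (th * c N)) (c N) V (th * S).
transitivity ((expR (th * x + th ^+ 2 * c N ^+ 2 / 2) *
   fold_mass m (th * c N))%:E *
  (K%:E * smear (fold_density m (th * c N)) (c N) (fun y => V (y + th * S)%R)
    (x + th * c N ^+ 2)%R))%E.
  congr (_ * _)%E; rewrite /smear -ge0_integralZl//=.
  - by apply: eq_integral => s _; rewrite muleA.
  - exact: (measurable_smear_integrand _ _ df dVS).
  - by move=> y _; exact: (smear_integrand_ge0 _ _ _ df dVS).
rewrite dfS muleA -EFinM; congr ((_)%:E * smear _ _ _ _)%E; last by ring.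
have AC (e1 p e2 k : R) : e1 * p * (e2 * k) = e1 * e2 * (k * p) by ring.
by rewrite /K AC -expRD; congr (expR _ * _); field.
Qed.

(** This is what makes tilting at rate r act on the tail event: the half-line
    indicator is e^(r y) times an integrable function of total mass 1/r. *)
Lemma scaled_half_line (r y : R) :
  (r * (0 <= y)%R%:R)%:E = ((expR (r * y))%:E * expo r y)%E.
Proof.
rewrite -EFinM /expo; case: (leP 0 y) => y0.
  by rewrite exponential_pdfE// mulr1 mulrCA mulNr expRN divff ?mulr1// gt_eqF ?expR_gt0.
by rewrite lt0_exponential_pdf// !mulr0.
Qed.

End tilting.

(** * Sums of functions of independent variables *)

Section independent_sum.
Context d (T : measurableType d) (R : realType) (P : probability T R).
Variables (Z : nat -> {RV P >-> R}) (g : R -> R) (c : nat -> R).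
Hypothesis mg : measurable_fun [set: R] g.
Hypothesis Z_indep : mutually_independent Z.

Definition partial_sum (N : nat) (w : T) : R := \sum_(i < N) c i * g (Z i w).

Lemma measurable_partial_sum N : measurable_fun [set: T] (partial_sum N).
Proof.
apply: measurable_sum => i; apply: measurable_funM => //.
by apply: (measurableT_comp mg).
Qed.

HB.instance Definition _ N :=
  isMeasurableFun.Build _ _ _ _ (partial_sum N) (measurable_partial_sum N).

Lemma partial_sumS N w : partial_sum N.+1 w = partial_sum N w + c N * g (Z N w).
Proof. by rewrite /partial_sum big_ord_recr. Qed.

Lemma measurable_preimageT d' (T' : measurableType d') (f : T -> T') A :
  measurable_fun setT f -> measurable A -> measurable (f @^-1` A).
Proof. by move=> mf mA; rewrite -[X in measurable X]setTI; exact: mf. Qed.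

Lemma measurable_bigcap_preimage (J : {fset nat}) (B : nat -> set R) :
  (forall i, i \in J -> measurable (B i)) ->
  measurable (\bigcap_(i in [set` J]) (Z i @^-1` B i)).
Proof.
move=> mB; apply: fin_bigcap_measurable => // i iJ.
by apply: measurable_preimageT => //; exact: mB.
Qed.

Lemma bigcap_preimage_head (N : nat) (J : {fset nat}) (B : nat -> set R)
    (A : set R) : N \notin J ->
  \bigcap_(i in [set` (N |` J)%fset]) (Z i @^-1` (if i == N then A else B i)) =
  Z N @^-1` A `&` \bigcap_(i in [set` J]) (Z i @^-1` B i).
Proof.
move=> NJ; have BJ i : i \in J -> (if i == N then A else B i) = B i.
  by move=> iJ; case: eqP => // iN; rewrite -iN iJ in NJ.
apply/seteqP; split => w.
- move=> h; split.
    by have := h N; rewrite /= in_fset1U eqxx; exact.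
  move=> i /= iJ; have := h i; rewrite /= in_fset1U iJ orbT BJ//; exact.
- move=> [hN hJ] i /=; rewrite in_fset1U => /orP[/eqP ->|iJ].
    by rewrite eqxx.
  by rewrite BJ//; exact: hJ.
Qed.

Lemma independent_head (N : nat) (J : {fset nat}) (B : nat -> set R) (A : set R) :
  N \notin J -> measurable A -> (forall i, i \in J -> measurable (B i)) ->
  P (Z N @^-1` A `&` \bigcap_(i in [set` J]) (Z i @^-1` B i)) =
  (P (Z N @^-1` A) * P (\bigcap_(i in [set` J]) (Z i @^-1` B i)))%E.
Proof.
move=> NJ mA mB; pose B' i := if i == N then A else B i.
have mB' i : i \in (N |` J)%fset -> measurable (B' i).
  rewrite in_fset1U /B'; case: eqP => // _ /= iJ; exact: mB.
have EJ := Z_indep mB.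
have := Z_indep mB'; rewrite bigcap_preimage_head// => ->.
rewrite big_fsetU1//= EJ; congr (_ * _)%E; first by rewrite /B' eqxx.
apply: eq_big_seq => i iJ; rewrite /B'; case: eqP => // iN.
by rewrite -iN iJ in NJ.
Qed.

Definition sum_and_next N (w : T) : R * R := (partial_sum N w, Z N w).

Lemma measurable_sum_and_next N : measurable_fun [set: T] (sum_and_next N).
Proof. by apply: measurable_fun_pair => //; exact: measurable_partial_sum. Qed.


(** The partial sum of the first N terms is independent of every finite family
    of later variables. Keeping the later family in the statement is what lets
    the induction on N go through. *)
Definition head_indep N := forall (J : {fset nat}) (B : nat -> set R) (A : set R),
  (forall i, i \in J -> (N <= i)%N) -> (forall i, i \in J -> measurable (B i)) ->
  measurable A ->
  P (partial_sum N @^-1` A `&` \bigcap_(i in [set` J]) (Z i @^-1` B i)) =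
  (P (partial_sum N @^-1` A) * P (\bigcap_(i in [set` J]) (Z i @^-1` B i)))%E.

Lemma head_indep_rect N (J : {fset nat}) (B : nat -> set R) (X Y : set R) :
  head_indep N ->
  (forall i, i \in J -> (N < i)%N) -> (forall i, i \in J -> measurable (B i)) ->
  measurable X -> measurable Y ->
  P (partial_sum N @^-1` X `&`
     (Z N @^-1` Y `&` \bigcap_(i in [set` J]) (Z i @^-1` B i))) =
  (P (partial_sum N @^-1` X) *
    (P (Z N @^-1` Y) * P (\bigcap_(i in [set` J]) (Z i @^-1` B i))))%E.
Proof.
move=> IH JN mB mX mY; pose B' i := if i == N then Y else B i.
have NJ : N \notin J by apply/negP => /JN; rewrite ltnn.
have mB' i : i \in (N |` J)%fset -> measurable (B' i).
  rewrite in_fset1U /B'; case: eqP => // _ /= iJ; exact: mB.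
have NJ' i : i \in (N |` J)%fset -> (N <= i)%N.
  by rewrite in_fset1U => /orP[/eqP ->//|/JN/ltnW].
have := IH _ _ _ NJ' mB' mX; rewrite bigcap_preimage_head// => ->.
by rewrite independent_head.
Qed.

Definition pair_law N : {measure set (R * R) -> \bar R} :=
  image_measure P (measurable_sum_and_next N).

Lemma pair_law_product N (X : set (R * R)) : head_indep N -> measurable X ->
  (distribution P (partial_sum N) \x distribution P (Z N))%E X = pair_law N X.
Proof.
move=> IH mX; apply: product_measure_unique => // A B mA mB.
have no i : i \in (fset0 : {fset nat}) -> (N < i)%N by [].
have no' i : i \in (fset0 : {fset nat}) -> measurable ((fun=> set0 : set R) i) by [].
have := head_indep_rect IH no no' mA mB.
by rewrite set_fset0 bigcap_set0 setIT probability_setT mule1.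
Qed.

(** The event on the later variables is carried along as a restriction of the
    measure: the law of the pair (sum, next variable) under the restricted
    measure is the product measure scaled by the probability of that event,
    because both agree on rectangles. *)
Lemma head_indepP N : head_indep N.
Proof.
elim: N => [|N IH] J B A JN mB mA.
  have -> : partial_sum 0 = cst 0 by apply/funext => w; rewrite /partial_sum big_ord0.
  by rewrite preimage_cst; case: ifP => _; rewrite ?setTI ?probability_setT ?mul1e//
    set0I measure0 mul0e.
set E := \bigcap_(i in _) _.
have mE : measurable E by exact: measurable_bigcap_preimage.
have [p p0 PE] : exists2 p, 0 <= p & P E = p%:E.
  by exists (fine (P E)); rewrite ?fine_ge0// fineK// fin_num_measure.
pose m2 := mscale (NngNum p0) (distribution P (Z N)).
pose pairE := image_measure (mrestr P mE) (measurable_sum_and_next N).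
have pairEP C : measurable C -> (distribution P (partial_sum N) \x m2)%E C = pairE C.
  move=> mC; apply: product_measure_unique => // X Y mX mY.
  have := head_indep_rect IH JN mB mX mY.
  rewrite -/E setIA [X in (_ * X)%E]muleC PE; exact.
have pairP C : measurable C -> (distribution P (partial_sum N) \x m2)%E C =
    mscale (NngNum p0) (pair_law N) C.
  move=> mC; apply: product_measure_unique => // X Y mX mY.
  transitivity (p%:E * pair_law N (X `*` Y))%E; first by [].
  rewrite -pair_law_product//; last exact: measurableX.
  rewrite product_measure1E// muleCA; exact.
pose C : set (R * R) := [set z | A (z.1 + c N * g z.2)].
have mC : measurable C.
  rewrite -[C]setTI; apply: (_ : measurable_fun setT (fun z : R * R => z.1 + c N * g z.2)) => //.
  apply: measurable_funD => //; apply: measurable_funM => //.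
  exact: (measurableT_comp mg).
have SC : partial_sum N.+1 @^-1` A = sum_and_next N @^-1` C.
  by apply/seteqP; split => w; rewrite /= partial_sumS.
have := pairEP C mC; rewrite pairP// => h.
transitivity (pairE C); first by rewrite SC.
rewrite -h SC PE muleC; exact.
Qed.

(** By induction on N, integrating out the last variable outermost. *)
Lemma expectation_partial_sum (q : R -> R) :
  nndens q ->
  (forall n v, nnmeas v ->
    \int[P]_w v (g (Z n w)) = \int[lebesgue_measure]_y (v y * (q y)%:E))%E ->
  forall N v x, nnmeas v ->
    (\int[P]_w v (x + partial_sum N w)%R = smears (fun=> q) c N v x)%E.
Proof.
move=> dq lawq; elim=> [|N IH] v x dv.
  under eq_integral do rewrite /partial_sum big_ord0 addr0.
  rewrite integral_cst// (_ : _ [set: T] = 1%E) ?mule1//.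
  exact: probability_setT.
have [mv v0] := dv.
pose F (z : R * R) := v (x + (z.1 + c N * g z.2)).
have mF : measurable_fun [set: R * R] F.
  apply: (measurableT_comp mv); apply: measurable_funD => //.
  apply: measurable_funD => //; apply: measurable_funM => //.
  exact: (measurableT_comp mg).
have F0 z : (0 <= F z)%E by exact: v0.
transitivity (\int[pair_law N]_z F z)%E.
  rewrite ge0_integral_image_measure//.
  by apply: eq_integral => w _; rewrite /F/= partial_sumS.
transitivity (\int[(distribution P (partial_sum N) \x distribution P (Z N))%E]_z F z)%E.
  apply: eq_measure_integral => A mA _.
  by rewrite -pair_law_product//; exact: head_indepP.
rewrite fubini_tonelli2//.
transitivity (\int[distribution P (Z N)]_z
    smears (fun=> q) c N v (x + c N * g z)%R)%E.
  apply: eq_integral => z _; rewrite -IH// /fubini_G ge0_integral_distribution//=.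
  - by apply: eq_integral => w _; rewrite /F/= [in RHS]addrAC addrA.
  - by apply: (measurableT_comp mF); exact: measurable_pair2.
have [mS S0] := nnmeas_smears c N (fun=> dq) dv.
have mSx : measurable_fun [set: R] (fun y => smears (fun=> q) c N v (x + c N * y)).
  by apply: (measurableT_comp mS); exact: measurable_affine.
rewrite ge0_integral_distribution//=; last exact: (measurableT_comp mSx mg).
by apply: (lawq N (fun y => smears (fun=> q) c N v (x + c N * y))); split.
Qed.

End independent_sum.

(** * The logarithm of the tilted mass *)

Section log_mass.
Context {R : realType}.
Implicit Types (m t x y : R).

(** The contribution of the folded half-line to fold_mass. *)
Definition back_mass m t : R := expR (- (2 * m * t)) * Phi (t - m).

Definition dmass m t : R := 2 * phi (t + m) - 2 * m * back_mass m t.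

Definition d2mass m t : R :=
  - (2 * (t + m)) * phi (t + m) - 2 * m * (- (2 * m) * back_mass m t + phi (t + m)).

Lemma is_derive_shift (f : R -> R) (l a t : R) :
  is_derive (t + a) (1 : R) f l -> is_derive t (1 : R) (fun s => f (s + a)) l.
Proof.
move=> df; have h : is_derive t (1 : R) (fun s : R => s + a) 1.
  by apply: is_derive_eq; rewrite addr0.
by have := @is_derive1_comp R f (fun s => s + a) t l 1 df h; rewrite mulr1.
Qed.

Lemma is_derive_back_mass m t :
  is_derive t (1 : R) (back_mass m) (- (2 * m) * back_mass m t + phi (t + m)).
Proof.
have d1 := is_derive_shift (is_derive_Phi (t + - m)).
have d2 : is_derive t (1 : R) (fun s => expR (- (2 * m * s)))
    (- (2 * m) * expR (- (2 * m * t))).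
  apply: is_derive_eq; rewrite /GRing.scale/=; ring.
have := is_deriveM d2 d1.
rewrite /back_mass => h; apply: is_derive_eq.
rewrite /GRing.scale/=.
have -> : phi (t + m) = phi (t - m) * expR (- (2 * m * t)).
  rewrite (_ : t + m = t - m + 2 * m); last by ring.
  by rewrite phiD; congr (_ * expR _); field.
ring.
Qed.

Lemma is_derive_fold_mass m t :
  is_derive t (1 : R) (fold_mass m) (dmass m t).
Proof.
have d1 := is_derive_shift (is_derive_Phi (t + m)).
have d2 := is_derive_back_mass m t.
have h := is_deriveD d1 d2.
by apply: (is_derive_eq h); rewrite /dmass; ring.
Qed.

Lemma is_derive_dmass m t : is_derive t (1 : R) (dmass m) (d2mass m t).
Proof.
have d1 := is_derive_shift (is_derive_phi (t + m)).
have d2 := is_derive_back_mass m t.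
have h := is_deriveB (is_deriveZ 2 d1) (is_deriveZ (2 * m) d2).
by apply: (is_derive_eq h); rewrite /d2mass /GRing.scale/=; ring.
Qed.

Definition log_mass m t : R := ln (fold_mass m t).

Definition dlog_mass m t : R := dmass m t / fold_mass m t.

Lemma is_derive_log_mass m t : 0 <= m -> 0 <= t ->
  is_derive t (1 : R) (log_mass m) (dlog_mass m t).
Proof.
move=> m0 t0; have h0 := fold_mass_gt0 m0 t0.
have h := @is_derive1_comp R (@ln R) (fold_mass m) t _ _
  (is_derive1_ln h0) (is_derive_fold_mass m t).
by apply: (is_derive_eq h); rewrite /dlog_mass mulrC.
Qed.

(** The derivative of log_mass with respect to the logarithm of t: it measures
    the effect on log_mass of a relative change of the argument. *)
Definition elasticity m t : R := t * dlog_mass m t.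

Definition delasticity m t : R := dlog_mass m t +
  t * (d2mass m t / fold_mass m t - dlog_mass m t ^+ 2).

Lemma is_derive_elasticity m t : 0 <= m -> 0 <= t ->
  is_derive t (1 : R) (elasticity m) (delasticity m t).
Proof.
move=> m0 t0; have h0 := fold_mass_gt0 m0 t0.
have dV := is_deriveV (lt0r_neq0 h0) (is_derive_fold_mass m t).
have h := is_deriveM (is_derive_id t (1 : R)) (is_deriveM (is_derive_dmass m t) dV).
apply: (is_derive_eq h); rewrite /delasticity /dlog_mass /GRing.scale/= fctE.
by field; rewrite gt_eqF.
Qed.

Lemma exp_decay (c : R) : 0 < c ->
  exists2 C, 0 <= C & forall t, 0 <= t -> expR (- (c * t)) <= C * (1 + t)^-1 ^+ 4.
Proof.
move=> c0; pose k := Num.min 1 (c / 4).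
have k0 : 0 < k by rewrite lt_min ltr01 divr_gt0.
exists (k^-1 ^+ 4) => [|t t0]; first by rewrite exprn_ge0// invr_ge0 ltW.
have t1 : 0 < 1 + t by lra.
rewrite -exprMn -invfM expRN exprVn lef_pV2 ?posrE ?expR_gt0 ?exprn_gt0 ?mulr_gt0//.
have -> : c * t = 4%:R * (c * t / 4) by field.
rewrite expRM_natl lerXn2r ?nnegrE ?expR_ge0 ?mulr_ge0 ?(ltW k0) ?(ltW t1)//.
apply: le_trans (expR_ge1Dx _); rewrite mulrDr mulr1 lerD//.
  by rewrite /k ge_min lexx.
by rewrite mulrAC ler_wpM2r// /k ge_min lexx orbT.
Qed.

(** Gaussian and exponential decay dominate every power; the fourth makes
    elasticity decay and its derivative integrable. *)
Lemma mass_decay m : 0 <= m -> exists2 K, 0 <= K & forall t, 0 <= t ->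
  phi (t + m) <= K * (1 + t)^-1 ^+ 4 /\ m * back_mass m t <= K * (1 + t)^-1 ^+ 4.
Proof.
move=> m0; have [C1 C10 h1] := exp_decay ltr01.
have phid t : 0 <= t -> phi (t + m) <= phi 0 * expR (2^-1) * C1 * (1 + t)^-1 ^+ 4.
  move=> t0; apply: (@le_trans _ _ (phi t)).
    by apply: phi_anti; rewrite t0 lerDl.
  apply: (@le_trans _ _ (phi 0 * expR 2^-1 * expR (- (1 * t)))); last first.
    rewrite -[leRHS]mulrA ler_wpM2l ?mulr_ge0 ?phi_ge0 ?expR_ge0//; exact: h1.
  rewrite phiE -mulrA -expRD ler_wpM2l ?phi_ge0// ler_expR.
  by have := sqr_ge0 (t - 1); rewrite sqrrB1; lra.
have q0 t : 0 <= t -> 0 <= (1 + t)^-1 ^+ 4 :> R.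
  by move=> t0; rewrite exprn_ge0// invr_ge0; lra.
set K1 := phi 0 * _ * _ in phid.
have K10 : 0 <= K1 by rewrite !mulr_ge0 ?phi_ge0 ?expR_ge0.
have [mE|mn0] := eqVneq m 0.
  exists K1 => // t t0; split; first exact: phid.
  by rewrite mE mul0r; apply: mulr_ge0 => //; exact: q0.
have mp : 0 < 2 * m by rewrite mulr_gt0// lt_neqAle eq_sym mn0.
have [C2 C20 h2] := exp_decay mp.
exists (K1 + m * C2); first by rewrite addr_ge0// mulr_ge0.
move=> t t0; have p1 := phid t t0; have p2 := h2 t t0; have p3 := q0 t t0.
rewrite mulrDl; split.
  by apply: le_trans p1 _; rewrite lerDl; apply: mulr_ge0 => //; apply: mulr_ge0.
apply: (@le_trans _ _ (m * C2 * (1 + t)^-1 ^+ 4)); last first.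
  by rewrite lerDr; exact: mulr_ge0.
rewrite -[leRHS]mulrA ler_wpM2l//; apply: le_trans p2.
by rewrite /back_mass ler_piMr ?expR_ge0 ?Phi_le1.
Qed.

Lemma back_mass_ge0 m t : 0 <= back_mass m t.
Proof. by rewrite mulr_ge0 ?expR_ge0 ?Phi_ge0. Qed.

Lemma log_mass_bounds m : 0 <= m -> exists2 C, 0 <= C & forall t, 0 <= t ->
  [/\ `|dlog_mass m t| <= C, `|elasticity m t| <= C * (1 + t)^-1 &
      `|delasticity m t| <= C * (1 + t)^-1 ^+ 2].
Proof.
move=> m0; have [K K0 hK] := mass_decay m0.
pose a : R := (phi 1)^-1.
have a0 : 0 <= a by rewrite invr_ge0 phi_ge0.
exists (a * (4 * K) + a * ((2 + 8 * m) * K) + (a * (4 * K)) ^+ 2).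
  by rewrite !addr_ge0 ?sqr_ge0// !mulr_ge0// addr_ge0// mulr_ge0.
move=> t t0; have [p1 p2] := hK t t0.
have b0 : 0 <= m * back_mass m t by rewrite mulr_ge0// back_mass_ge0.
have f0 := phi_ge0 (t + m).
set q : R := (1 + t)^-1 in p1 p2 *.
have q0 : 0 <= q by rewrite invr_ge0; lra.
have tq : t * q = 1 - q by rewrite /q; field; lra.
have q1 : q <= 1 by rewrite /q invf_le1; lra.
have qt1 : t * q <= 1 by lra.
have h0 := fold_mass_gt0 m0 t0.
have ha : (fold_mass m t)^-1 <= a by rewrite lef_pV2 ?posrE ?phi_gt0// fold_mass_ge.
have hV0 : 0 <= (fold_mass m t)^-1 by rewrite invr_ge0 ltW.
have q2 : 0 <= q ^+ 2 by exact: sqr_ge0.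
have q2q : q ^+ 2 <= q by rewrite expr2 ler_piMr.
have q4 : q ^+ 4 <= q ^+ 2.
  by rewrite (_ : q ^+ 4 = q ^+ 2 * q ^+ 2) ?ler_piMr//; [lra|ring].
have q40 : 0 <= q ^+ 4 by exact: exprn_ge0.
have d1 : `|dmass m t| <= 4 * K * q ^+ 4.
  by rewrite /dmass ler_norml; apply/andP; split; lra.
have d2 : `|d2mass m t| <= (2 * t + 8 * m) * (K * q ^+ 4).
  have e1 : 0 <= t * phi (t + m) <= t * (K * q ^+ 4).
    by rewrite mulr_ge0//= ler_wpM2l.
  have e2 : 0 <= m * phi (t + m) <= m * (K * q ^+ 4).
    by rewrite mulr_ge0//= ler_wpM2l.
  have e3 : 0 <= m * (m * back_mass m t) <= m * (K * q ^+ 4).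
    by rewrite mulr_ge0//= ler_wpM2l.
  rewrite /d2mass ler_norml; apply/andP; split; lra.
have l1 : `|dlog_mass m t| <= a * (4 * K) * q ^+ 4.
  rewrite /dlog_mass normrM (ger0_norm hV0).
  rewrite (_ : a * (4 * K) * q ^+ 4 = 4 * K * q ^+ 4 * a); last by ring.
  exact: ler_pM.
pose A := a * (4 * K); rewrite -/A in l1 *.
pose B := a * ((2 + 8 * m) * K); rewrite -/B.
have A0 : 0 <= A by rewrite !mulr_ge0.
have B0 : 0 <= B by rewrite !mulr_ge0// addr_ge0// mulr_ge0.
have A20 : 0 <= A ^+ 2 by exact: sqr_ge0.
have Aq4 : A * q ^+ 4 <= A * q ^+ 2 by rewrite ler_wpM2l.
have Aq2 : A * q ^+ 2 <= A * q by rewrite ler_wpM2l.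
have Aq : A * q <= A by rewrite ler_piMr.
have q3 : q ^+ 3 <= q ^+ 2 by rewrite exprS ler_piMl.
split.
- by lra.
- rewrite /elasticity normrM (ger0_norm t0).
  apply: (@le_trans _ _ (t * (A * q ^+ 4))); first by rewrite ler_wpM2l.
  rewrite (_ : t * (A * q ^+ 4) = A * (t * q) * q ^+ 3); last by ring.
  apply: (@le_trans _ _ (A * q)).
    rewrite -mulrA ler_wpM2l// -[leRHS]mul1r ler_pM ?exprn_ge0 ?mulr_ge0//; lra.
  by rewrite ler_wpM2r//; lra.
- rewrite /delasticity; apply: le_trans (ler_normD _ _) _.
  rewrite (normrM t) (ger0_norm t0).
  have s1 : `|d2mass m t / fold_mass m t| <= (2 * t + 8 * m) * (K * q ^+ 4) * a.
    by rewrite normrM (ger0_norm hV0) ler_pM.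
  have s2 : `|dlog_mass m t ^+ 2| <= (A * q ^+ 4) ^+ 2.
    by rewrite normrX lerXn2r ?nnegrE// mulr_ge0.
  have s3 : t * ((2 * t + 8 * m) * (K * q ^+ 4) * a) <= B * q ^+ 2.
    rewrite [leLHS](_ : _ = a * K * q ^+ 2 * ((t * q) * (2 * (t * q) + 8 * m * q))); last by ring.
    rewrite (_ : B * q ^+ 2 = a * K * q ^+ 2 * (1 * (2 + 8 * m))); last by rewrite /B; ring.
    have tq0 : 0 <= t * q by exact: mulr_ge0.
    have mq0 : 0 <= m * q by exact: mulr_ge0.
    have mqm : m * q <= m by rewrite ler_piMr.
    by rewrite ler_wpM2l ?mulr_ge0// ler_pM//; lra.
  have s4 : t * (A * q ^+ 4) ^+ 2 <= A ^+ 2 * q ^+ 2.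
    rewrite [leLHS](_ : _ = A ^+ 2 * q ^+ 2 * ((t * q) * q ^+ 5)); last by ring.
    rewrite ler_piMr ?mulr_ge0// -[leRHS]mul1r ler_pM ?exprn_ge0 ?mulr_ge0//.
    by rewrite exprn_ile1.
  have s5 : t * `|d2mass m t / fold_mass m t - dlog_mass m t ^+ 2| <=
      t * ((2 * t + 8 * m) * (K * q ^+ 4) * a + (A * q ^+ 4) ^+ 2).
    rewrite ler_wpM2l//; apply: le_trans (ler_normB _ _) _; exact: lerD.
  rewrite mulrDr in s5; lra.
Qed.

(** The variation of elasticity is dominated by that of a bounded monotone
    function. Hence it has uniformly bounded variation along all monotone
    sequences. *)
Lemma elasticity_variation m : 0 <= m -> exists2 C, 0 <= C & forall x y,
  0 <= x <= y -> `|elasticity m y - elasticity m x| <= C * ((1 + x)^-1 - (1 + y)^-1).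
Proof.
move=> m0; have [C C0 hC] := log_mass_bounds m0; exists C => // x y /andP[x0].
rewrite le_eqVlt => /orP[/eqP <-|xy]; first by rewrite !subrr normr0 mulr0.
(* Both sums of elasticity, up to sign, with the primitive -C/(1+t) of
   C/(1+t)^2 have a nonnegative derivative. *)
have dA z : x <= z <= y ->
    is_derive z (1 : R) (fun t : R => - C * (1 + t)^-1) (C * (1 + z)^-1 ^+ 2).
  move=> /andP[xz _]; have z1 : 1 + z != 0 by rewrite gt_eqF//; lra.
  have d1 : is_derive z (1 : R) (fun t : R => 1 + t) 1.
    by apply: is_derive_eq; rewrite add0r mulr1.
  have := is_deriveZ (- C) (is_deriveV z1 d1).
  by move=> h; apply: (is_derive_eq h); rewrite /GRing.scale/=; field.
have dG z : x <= z <= y ->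
    is_derive z (1 : R) (elasticity m) (delasticity m z).
  by move=> /andP[xz _]; apply: is_derive_elasticity => //; exact: le_trans xz.
have [z1 z1xy e1] := mean_value xy (fun z hz => is_deriveD (dA z hz) (dG z hz)).
have [z2 z2xy e2] := mean_value xy (fun z hz => is_deriveB (dA z hz) (dG z hz)).
have pos z : x < z < y ->
    0 <= C * (1 + z)^-1 ^+ 2 + delasticity m z /\
    0 <= C * (1 + z)^-1 ^+ 2 - delasticity m z.
  move=> /andP[xz _]; have z0 : 0 <= z by rewrite ltW// (le_lt_trans x0).
  have [_ _ hz] := hC z z0.
  move: hz; rewrite ler_norml => /andP[? ?].
  by apply: conj; [rewrite -lerBlDl sub0r|rewrite subr_ge0].
have yx : 0 <= y - x by lra.
have [p1 _] := pos _ z1xy; have [_ p2] := pos _ z2xy.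
have := mulr_ge0 p1 yx; have := mulr_ge0 p2 yx; rewrite -e1 -e2 !fctE.
rewrite ler_norml => ? ?; apply/andP; split; lra.
Qed.

End log_mass.

(** * Series estimates uniform in the number of terms *)

Section series_estimates.
Context {R : realType}.
Implicit Types (u v e : nat -> R).

Lemma series_ord u n : series u n = \sum_(i < n) u i.
Proof. by rewrite /series/= big_mkord. Qed.

Lemma sum_split u n k :
  \sum_(i < n + k) u i = \sum_(i < n) u i + \sum_(j < k) u (n + j)%N.
Proof. by rewrite big_split_ord. Qed.

Lemma series_tail_small u : cvgn (series u) -> forall eps, 0 < eps ->
  exists N, forall n, (N <= n)%N -> forall k, `|\sum_(j < k) u (n + j)%N| <= eps.
Proof.
move=> cu eps eps0; have e2 : 0 < eps / 2 by rewrite divr_gt0.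
have /cvgrPdist_le /(_ _ e2) [N _ hN] := cu.
exists N => n Nn k.
have -> : \sum_(j < k) u (n + j)%N = series u (n + k)%N - series u n.
  by rewrite !series_ord sum_split addrAC subrr add0r.
have h1 := hN n Nn; have h2 := hN (n + k)%N (leq_trans Nn (leq_addr _ _)).
rewrite /= in h1 h2.
rewrite -(subrKA (limn (series u))) (le_trans (ler_normD _ _))//.
by rewrite distrC [X in X + _]distrC; rewrite distrC in h2; lra.
Qed.

Lemma near_sum_small (F : R -> nat -> R) n : (forall i, F r i @[r --> +oo] --> (0 : R)) ->
  forall eps, 0 < eps -> \forall r \near +oo, \sum_(i < n) `|F r i| <= eps.
Proof.
move=> F0 eps eps0.
have : \sum_(i < n) `|F r i| @[r --> +oo] --> (0 : R).
  elim: n => [|n IH].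
    under eq_fun do rewrite big_ord0; exact: cvg_cst.
  under eq_fun do rewrite big_ord_recr/=.
  have h := cvgD IH (cvg_norm (F0 n)); rewrite normr0 addr0 in h.
  exact: h.
move=> /cvgrPdist_le /(_ _ eps0); apply: filterS => r; rewrite sub0r normrN.
by apply: le_trans; exact: ler_norm.
Qed.

Lemma sum_le_of_split (f : nat -> R) n0 (A B : R) :
  0 <= B -> \sum_(i < n0) `|f i| <= A ->
  (forall k, `|\sum_(j < k) f (n0 + j)%N| <= B) ->
  forall N, `|\sum_(i < N) f i| <= A + B.
Proof.
move=> B0 hA hB N; have [n0N|Nn0] := leqP n0 N.
  rewrite -(subnKC n0N) sum_split (le_trans (ler_normD _ _))// lerD//.
  exact: le_trans (ler_norm_sum _ _ _) hA.
apply: (@le_trans _ _ A); last by rewrite lerDl.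
apply: le_trans (ler_norm_sum _ _ _) _; apply: le_trans hA.
rewrite -(subnKC (ltnW Nn0)) (sum_split (fun i => `|f i|)) lerDl.
by apply: sumr_ge0.
Qed.

(** The tail of the dominating series takes care of all large indices at once;
    finitely many terms remain. *)
Lemma near_dominated_sum (F : R -> nat -> R) e n0 :
  cvgn (series e) -> (forall r n, 0 <= r -> (n0 <= n)%N -> `|F r n| <= e n) ->
  (forall i, F r i @[r --> +oo] --> (0 : R)) ->
  forall eps, 0 < eps -> \forall r \near +oo,
    forall N, `|\sum_(i < N) F r i| <= eps.
Proof.
move=> ce Fe F0 eps eps0; have e2 : 0 < eps / 2 by rewrite divr_gt0.
have [N hN] := series_tail_small ce e2.
pose n1 := maxn n0 N.
near=> r => M; rewrite (splitr eps); apply: (@sum_le_of_split (F r) n1).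
- by rewrite ltW.
- by near: r; exact: near_sum_small.
- have r0 : 0 <= r by near: r; apply: nbhs_pinfty_ge; exact: num_real.
  move=> k; apply: le_trans (ler_norm_sum _ _ _) _.
  apply: le_trans (hN n1 (leq_maxr _ _) k).
  apply: le_trans (ler_norm _); apply: ler_sum => j _; apply: Fe => //.
  exact: leq_trans (leq_maxl _ _) (leq_addr _ _).
Unshelve. all: by end_near. Qed.

(** Abel summation. The sequence A is a monotone majorant of the variation of
    g. *)
Lemma abel_sum_bound (g rho A : nat -> R) (delta : R) :
  (forall k, `|\sum_(j < k) rho j| <= delta) ->
  (forall i, `|g i.+1 - g i| <= A i.+1 - A i) ->
  0 <= A 0%N -> forall n,
  `|\sum_(i < n) g i * rho i| <= delta * (A n + `|g n|).
Proof.
move=> hd hA A0 n; have d0 : 0 <= delta by apply: le_trans (hd 0%N).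
have inv : `|\sum_(i < n) g i * rho i - g n * \sum_(j < n) rho j| <= delta * A n.
  elim: n => [|n IH]; first by rewrite !big_ord0 mulr0 subr0 normr0 mulr_ge0.
  rewrite [X in X - _]big_ord_recr/=.
  rewrite (_ : _ - _ = (\sum_(i < n) g i * rho i - g n * \sum_(j < n) rho j) +
    (g n - g n.+1) * \sum_(j < n.+1) rho j); last by rewrite big_ord_recr/=; ring.
  apply: le_trans (ler_normD _ _) _.
  rewrite (_ : delta * A n.+1 = delta * A n + (A n.+1 - A n) * delta); last by ring.
  by apply: lerD => //; rewrite normrM distrC ler_pM.
rewrite -[X in `|X|](subrK (g n * \sum_(j < n) rho j)) mulrDr.
apply: le_trans (ler_normD _ _) _; apply: lerD => //.
by rewrite normrM mulrC ler_pM.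
Qed.

End series_estimates.

(** * Comparison of the masses of two sequences *)

Section log_mass_ratio.
Context {R : realType}.
Variables (m : R) (u v : nat -> R).
Hypothesis m0 : 0 <= m.
Hypothesis u0 : forall n, 0 < u n.
Hypothesis v0 : forall n, 0 < v n.
Hypothesis v_noninc : nonincreasing_seq v.

Lemma log_mass_increment : exists2 C, 0 <= C & forall x y, 0 < x -> 0 < y ->
  `|log_mass m y - log_mass m x| <=
     C * (1 + Num.min x y)^-1 * (`|y - x| / Num.min x y).
Proof.
have [C C0 hC] := log_mass_bounds m0; exists C => // x y x0 y0.
wlog xy : x y x0 y0 / x < y => [H|].
  have [->|] := eqVneq x y; first by rewrite !subrr normr0 mul0r mulr0.
  rewrite neq_lt => /orP[xy|yx]; first exact: H.
  by rewrite distrC (distrC y) minC; exact: H.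
rewrite (min_idPl (ltW xy)).
have [z /andP[xz zy] ->] := mean_value xy
  (fun z hz => is_derive_log_mass m0 (le_trans (ltW x0) (proj1 (andP hz)))).
have z0 : 0 < z by exact: lt_trans xz.
have [_ hE _] := hC z (ltW z0).
have -> : dlog_mass m z * (y - x) = elasticity m z * ((y - x) / z).
  by rewrite /elasticity; field; rewrite gt_eqF.
rewrite normrM ler_pM//.
- apply: le_trans hE _; rewrite ler_wpM2l// lef_pV2 ?posrE; lra.
- by rewrite normrM (gtr0_norm (_ : 0 < z^-1)) ?invr_gt0// ler_wpM2l// lef_pV2// ltW.
Qed.

Lemma log_mass_increment_small (x y : R) : 0 < x -> 0 < y ->
  log_mass m (r * y) - log_mass m (r * x) @[r --> +oo] --> (0 : R).
Proof.
move=> x0 y0; have [C C0 hC] := log_mass_increment.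
have z0 : 0 < Num.min x y by rewrite lt_min x0.
pose D := C * (`|y - x| / Num.min x y).
have D0 : 0 <= D by rewrite mulr_ge0// divr_ge0// ltW.
apply/cvgrPdist_le => eps eps0; near=> r.
rewrite sub0r normrN.
have r0 : 0 < r by near: r; exact: nbhs_pinfty_gt.
apply: le_trans (hC _ _ (mulr_gt0 r0 x0) (mulr_gt0 r0 y0)) _.
rewrite -minr_pMr ?(ltW r0)// -mulrBr normrM (gtr0_norm r0).
rewrite (_ : _ * _ = D * (1 + r * Num.min x y)^-1); last first.
  rewrite /D; field; rewrite !gt_eqF//=.
  by rewrite addr_gt0// mulr_gt0.
rewrite ler_pdivrMr ?addr_gt0 ?mulr_gt0//.
have : D / (eps * Num.min x y) <= r by near: r; apply: nbhs_pinfty_ge; exact: num_real.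
rewrite ler_pdivrMr ?mulr_gt0// => h.
rewrite mulrDr mulr1; nra.
Unshelve. all: by end_near. Qed.

(** By the mean value theorem the increment is elasticity at an intermediate
    point times a relative increment; both are compared with their value at x,
    each at the cost of one more factor y / x - 1. *)
Lemma log_mass_first_order : exists2 C, 0 <= C & forall x y, 0 < x -> 0 < y ->
  `|y / x - 1| <= 2^-1 ->
  `|log_mass m y - log_mass m x - elasticity m x * (y / x - 1)| <=
     C * (y / x - 1) ^+ 2.
Proof.
have [C C0 hC] := log_mass_bounds m0; have [D D0 hD] := elasticity_variation m0.
exists (2 * D + 2 * C); first by rewrite addr_ge0// mulr_ge0.
move=> x y x0 y0; set rho := y / x - 1 => hrho.
have yE : y = x + x * rho by rewrite /rho; field; rewrite gt_eqF.
have between z : (x < z < y) \/ (y < z < x) ->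
    `|z - x| <= x * `|rho| /\ `|x * rho / z| <= 2 * `|rho|.
  move=> hz; have xr : `|x * rho| = x * `|rho| by rewrite normrM (gtr0_norm x0).
  have zx : `|z - x| <= `|x * rho|.
    have -> : x * rho = y - x by rewrite yE; ring.
    case: hz => /andP[h1 h2].
      by rewrite !ger0_norm; lra.
    by rewrite !ler0_norm; lra.
  have hx2 : x * `|rho| <= x * 2^-1 by rewrite ler_wpM2l// ltW.
  have z2 : x / 2 <= z.
    have := lerB_dist x z; rewrite (distrC x) (gtr0_norm x0) => h.
    by have := ler_norm z; case: hz => /andP[h1 h2]; [lra|];
      move: zx; rewrite xr ler_norml => /andP[]; lra.
  have z0 : 0 < z by apply: lt_le_trans z2; rewrite divr_gt0.
  split; first by rewrite -xr.
  rewrite normrM xr (gtr0_norm (_ : 0 < z^-1)) ?invr_gt0// ler_pdivrMr//.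
  have := normr_ge0 rho; nra.
have core z : (x < z < y) \/ (y < z < x) ->
   log_mass m y - log_mass m x = dlog_mass m z * (y - x) ->
   `|log_mass m y - log_mass m x - elasticity m x * rho| <=
     (2 * D + 2 * C) * rho ^+ 2.
  move=> hz ->; have [zx zr] := between z hz.
  have z0 : 0 < z by case: hz => /andP[h1 _]; [exact: lt_trans h1|exact: lt_trans h1].
  have -> : dlog_mass m z * (y - x) - elasticity m x * rho =
     (elasticity m z - elasticity m x) * (x * rho / z) +
     elasticity m x * (rho * ((x - z) / z)).
    rewrite {1}yE /elasticity; field; rewrite gt_eqF//.
  have Dv : `|elasticity m z - elasticity m x| <= D * `|rho|.
    have key p q : 0 < p -> p <= q -> (p = x \/ q = x) -> q - p = `|z - x| ->
        D * ((1 + p)^-1 - (1 + q)^-1) <= D * `|rho|.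
      move=> p0 pq px qp; rewrite ler_wpM2l//.
      have q0 : 0 < q by exact: lt_le_trans pq.
      rewrite (_ : _ - _ = (q - p) / ((1 + p) * (1 + q))); last first.
        by field; rewrite !gt_eqF//; lra.
      rewrite ler_pdivrMr ?mulr_gt0 ?addr_gt0// qp; apply: le_trans zx _.
      rewrite mulrC ler_wpM2l//; case: px => ->; nra.
    case: hz => /andP[h1 h2].
      apply: le_trans (hD x z _) _; first by rewrite !ltW.
      by apply: key => //; [exact: ltW|left|rewrite ger0_norm// subr_ge0 ltW].
    rewrite distrC; apply: le_trans (hD z x _) _; first by rewrite !ltW.
    apply: key => //; [exact: ltW|by right|].
    by rewrite distrC ger0_norm// subr_ge0 ltW.
  have [_ hE _] := hC x (ltW x0).
  have hE1 : `|elasticity m x| <= C.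
    apply: le_trans hE _; rewrite ler_piMr// invf_le1; lra.
  apply: le_trans (ler_normD _ _) _.
  rewrite [leRHS]mulrDl; apply: lerD.
    rewrite normrM (_ : 2 * D * rho ^+ 2 = (D * `|rho|) * (2 * `|rho|)); last first.
      by rewrite -(real_normK (num_real rho)); ring.
    exact: ler_pM.
  rewrite normrM (_ : 2 * C * rho ^+ 2 = C * (2 * `|rho| ^+ 2)); last first.
    by rewrite real_normK ?num_real//; ring.
  rewrite ler_pM// normrM expr2 mulrCA ler_wpM2l//.
  rewrite normrM distrC; apply: le_trans zr; rewrite [leRHS]normrM.
  by rewrite ler_wpM2r// (le_trans zx)// normrM (gtr0_norm x0).
have [yx|xy|yx] := ltgtP y x.
- have [z hz e] := mean_value yx
    (fun z hz => is_derive_log_mass m0 (le_trans (ltW y0) (proj1 (andP hz)))).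
  by apply: (core z); [right|rewrite -opprB e; ring].
- have [z hz e] := mean_value xy
    (fun z hz => is_derive_log_mass m0 (le_trans (ltW x0) (proj1 (andP hz)))).
  by apply: (core z); [left|].
- rewrite /rho yx divff ?gt_eqF// !subrr mulr0 subrr normr0 mulr_ge0 ?sqr_ge0//.
  by rewrite addr_ge0// mulr_ge0.
Qed.

Hypothesis ratio_cvg : cvgn (series (fun n => 1 - u n / v n)).
Hypothesis ratio_sq_cvg : cvgn (series (fun n => (1 - u n / v n) ^+ 2)).

(** To first order the sum is that of elasticity (r * v i) * (u i / v i - 1),
    up to a multiple of the sum of the squares. The hypothesis on the signed
    series applies through Abel summation, since elasticity has variation
    bounded independently of r along the monotone sequence r * v i. Beyond a
    fixed rank both parts are small for all r; the finitely many terms before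
    that rank tend to 0 as r grows. *)
Lemma log_mass_sum_close eps : 0 < eps -> \forall r \near +oo, forall N,
  `|\sum_(i < N) (log_mass m (r * u i) - log_mass m (r * v i))| <= eps.
Proof.
move=> eps0.
have [C C0 hC] := log_mass_first_order.
have [D D0 hD] := elasticity_variation m0.
have [E E0 hE] := log_mass_bounds m0.
pose rho i := u i / v i - 1.
have rhoE i : rho i = - (1 - u i / v i) by rewrite /rho opprB.
have e4 : 0 < eps / 4 by rewrite divr_gt0.
(* C multiplies the sum of the squares, D + E the Abel sum. *)
pose K := 1 + C + (D + E).
have K0 : 0 < K by rewrite /K; lra.
have eK : 0 < eps / 4 / K by rewrite divr_gt0.
have [N1 h1] := series_tail_small ratio_cvg eK.
have [N2 h2] := series_tail_small ratio_sq_cvg eK.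
have half : 0 < 2^-1 :> R by rewrite invr_gt0.
have [N3 h3] := series_tail_small ratio_cvg half.
pose N0 := maxn N1 (maxn N2 N3).
have N10 : (N1 <= N0)%N by exact: leq_maxl.
have N20 : (N2 <= N0)%N by rewrite /N0 (leq_trans _ (leq_maxr _ _)) ?leq_maxl.
have N30 : (N3 <= N0)%N by rewrite /N0 (leq_trans _ (leq_maxr _ _)) ?leq_maxr.
have rho_half j : `|rho (N0 + j)%N| <= 2^-1.
  have := h3 (N0 + j)%N (leq_trans N30 (leq_addr _ _)) 1%N.
  by rewrite big_ord_recl big_ord0 addr0 addn0 rhoE normrN.
near=> r => N.
have r0 : 0 < r by near: r; exact: nbhs_pinfty_gt.
rewrite (_ : eps = eps / 4 + (eps / 4 + (eps / 4 + eps / 4))); last by field.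
pose F s i := log_mass m (s * u i) - log_mass m (s * v i).
apply: (@sum_le_of_split _ (F r) N0); first by lra.
- near: r; apply: (@near_sum_small _ F) => // i.
  exact: log_mass_increment_small.
- move=> k.
  pose x j := r * v (N0 + j)%N; pose y j := r * u (N0 + j)%N.
  have x0 j : 0 < x j by rewrite mulr_gt0.
  have y0 j : 0 < y j by rewrite mulr_gt0.
  have yx j : y j / x j - 1 = rho (N0 + j)%N.
    by rewrite /y /x /rho; field; rewrite !gt_eqF.
  pose rem j := log_mass m (y j) - log_mass m (x j) -
     elasticity m (x j) * rho (N0 + j)%N.
  rewrite (_ : \sum_(j < k) _ = \sum_(j < k) rem j +
    \sum_(j < k) elasticity m (x j) * rho (N0 + j)%N); last first.
    by rewrite -big_split/=; apply: eq_bigr => j _; rewrite /rem subrK.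
  apply: le_trans (ler_normD _ _) _; apply: lerD.
  + apply: le_trans (ler_norm_sum _ _ _) _.
    apply: (@le_trans _ _ (\sum_(j < k) C * (1 - u (N0 + j)%N / v (N0 + j)%N) ^+ 2)).
      apply: ler_sum => j _; rewrite -(sqrrN (1 - _)) -rhoE -yx.
      rewrite /rem -yx; apply: hC => //; by rewrite yx.
    rewrite -mulr_sumr; have := h2 N0 N20 k => /(le_trans (ler_norm _)) h.
    apply: (@le_trans _ _ (C * (eps / 4 / K))); first by rewrite ler_wpM2l.
    rewrite (_ : C * (eps / 4 / K) = eps / 4 * (C / K)); last by ring.
    by rewrite ler_piMr ?(ltW e4)// ler_pdivrMr// mul1r /K; lra.
  + have sumrho l : `|\sum_(j < l) rho (N0 + j)%N| <= eps / 4 / K.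
      under eq_bigr do rewrite rhoE.
      by rewrite sumrN normrN; exact: h1.
    have var i : `|elasticity m (x i.+1) - elasticity m (x i)| <=
        D * (1 + x i.+1)^-1 - D * (1 + x i)^-1.
      rewrite -mulrBr distrC; apply: hD; rewrite ltW//=.
      by rewrite /x ler_wpM2l ?(ltW r0)//; apply: v_noninc; rewrite addnS.
    have A0 : 0 <= D * (1 + x 0%N)^-1.
      by rewrite mulr_ge0// invr_ge0 addr_ge0// ltW.
    apply: le_trans (@abel_sum_bound _ (fun j => elasticity m (x j))
      (fun j => rho (N0 + j)%N) (fun j => D * (1 + x j)^-1) _ sumrho var A0 k) _.
    have [_ hEk _] := hE (x k) (ltW (x0 k)).
    have inv1 : (1 + x k)^-1 <= 1 by rewrite invf_le1; have := x0 k; lra.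
    have b1 : D * (1 + x k)^-1 + `|elasticity m (x k)| <= D + E.
      apply: lerD; first by rewrite ler_piMr.
      by apply: le_trans hEk _; rewrite ler_piMr.
    apply: (@le_trans _ _ (eps / 4 / K * (D + E))).
      by rewrite ler_wpM2l// ltW.
    rewrite (_ : eps / 4 / K * (D + E) = eps / 4 * ((D + E) / K)); last by ring.
    apply: (@le_trans _ _ (eps / 4)); last by lra.
    by rewrite ler_piMr ?(ltW e4)// ler_pdivrMr// mul1r /K; lra.
Unshelve. all: by end_near. Qed.

End log_mass_ratio.

(** * The tilted expectation is asymptotically Gaussian *)

Section tilted_quotient.
Context {R : realType}.
Variables (m : R) (c : nat -> R).
Hypothesis m0 : 0 <= m.
Hypothesis c0 : forall n, 0 < c n.
Hypothesis c_summable : cvgn (series c).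
Hypothesis c_unit : series (fun n => c n ^+ 2) @ \oo --> (1 : R).

Lemma fold_err_le (t : R) : 1 <= t ->
  fold_err m t <= (4 + (if m == 0 then 0 else (2 * m)^-1)) / t.
Proof.
move=> t1; have t0 : 0 < t by lra.
have expN x : 0 < x -> expR (- x) <= x^-1 :> R.
  move=> x0; rewrite expRN lef_pV2 ?posrE ?expR_gt0//.
  by apply: le_trans (expR_ge1Dx x); lra.
rewrite mulrDl /fold_err; apply: lerD.
  have h : expR (- (t ^+ 2 / 2)) <= (t / 2)^-1.
    apply: le_trans (expN (t / 2) _); last by rewrite divr_gt0.
    by rewrite ler_expR lerN2 ler_wpM2r// expr2 ler_peMr// ltW.
  apply: (@le_trans _ _ (2 * (t / 2)^-1)); first by rewrite ler_wpM2l.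
  by rewrite le_eqVlt; apply/orP; left; apply/eqP; field; rewrite gt_eqF.
case: ifPn => mn0; first by rewrite mul0r.
have mp : 0 < 2 * m by rewrite mulr_gt0// lt_neqAle eq_sym mn0.
by apply: le_trans (expN _ (mulr_gt0 mp t0)) _; rewrite invfM.
Qed.

Lemma fold_err_cvg0 (k : R) : 0 < k ->
  fold_err m (r * k) @[r --> +oo] --> (0 : R).
Proof.
move=> k0; set D := 4 + (if m == 0 then 0 else (2 * m)^-1).
have D0 : 0 <= D.
  rewrite addr_ge0//; case: ifP => // _; by rewrite invr_ge0 mulr_ge0.
apply/cvgrPdist_le => eps eps0; near=> r.
rewrite sub0r normrN ger0_norm ?fold_err_ge0//.
have r0 : 0 < r by near: r; exact: nbhs_pinfty_gt.
have r1 : k^-1 <= r by near: r; apply: nbhs_pinfty_ge; exact: num_real.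
have r2 : D / (k * eps) <= r by near: r; apply: nbhs_pinfty_ge; exact: num_real.
apply: le_trans (fold_err_le _) _.
  by move: r1; rewrite -[k^-1]div1r ler_pdivrMr.
rewrite -/D ler_pdivrMr ?mulr_gt0//.
by move: r2; rewrite ler_pdivrMr ?mulr_gt0// => r2; rewrite mulrC -mulrA.
Unshelve. all: by end_near. Qed.

Let B := phi 0 / c 0%N.
Let L := phi 0 / c 0%N ^+ 2.
Let C := 2 * phi_moment / phi 1 + phi_moment : R.

(** Price of replacing the n-th tilted density by the Gaussian one. The first
    bound of the minimum tends to 0 as r grows, for fixed n; the second one is
    summable in n, uniformly in r, because the weights are. *)
Definition smear_gap (r : R) (n : nat) : R :=
  if n is 0%N then 4 * phi 0 / phi 1 * fold_err m (r * c 0%N) / c 0%N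
  else Num.min (B * (4 / phi 1 * fold_err m (r * c n))) (C * L * c n).

Let B0 : 0 <= B. Proof. by rewrite divr_ge0 ?phi_ge0// ltW. Qed.
Let L0 : 0 <= L. Proof. by rewrite divr_ge0 ?phi_ge0// sqr_ge0. Qed.
Let C0 : 0 <= C.
Proof.
by rewrite /C addr_ge0 ?phi_moment_ge0// divr_ge0 ?phi_ge0// mulr_ge0 ?phi_moment_ge0.
Qed.

Let gapB n r : 0 <= B * (4 / phi 1 * fold_err m (r * c n)).
Proof.
apply: mulr_ge0; first exact: B0.
by rewrite mulr_ge0 ?fold_err_ge0// divr_ge0 ?phi_ge0.
Qed.

Lemma smear_gap_ge0 r n : 0 <= smear_gap r n.
Proof.
case: n => [|n] /=.
  by rewrite divr_ge0 ?(ltW (c0 0%N))// mulr_ge0 ?fold_err_ge0// divr_ge0 ?mulr_ge0 ?phi_ge0.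
rewrite le_min gapB; apply: mulr_ge0; last exact: ltW.
by apply: mulr_ge0; [exact: C0|exact: L0].
Qed.

Lemma smear_gap_cvg0 n : smear_gap r n @[r --> +oo] --> (0 : R).
Proof.
have F := fold_err_cvg0 (c0 n).
case: n F => [|n] F /=.
  have h := cvgMr_tmp (b := (c 0%N)^-1) (cvgMl_tmp (a := 4 * phi 0 / phi 1) F).
  rewrite mulr0 mul0r in h; exact: h.
have G : B * (4 / phi 1 * fold_err m (r * c n.+1)) @[r --> +oo] --> (0 : R).
  have h := cvgMl_tmp (a := B) (cvgMl_tmp (a := 4 / phi 1) F).
  rewrite !mulr0 in h; exact: h.
apply: (@squeeze_cvgr _ _ _ _ (cst 0) _ _ _ _ _ G); last exact: cvg_cst.
near=> r; rewrite ge_min lexx /= andbT.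
exact: (smear_gap_ge0 r n.+1).
Unshelve. all: by end_near. Qed.

Lemma smear_gap_sum_small eps : 0 < eps -> \forall r \near +oo, forall N,
  \sum_(i < N) smear_gap r i <= eps.
Proof.
move=> eps0; have cK : cvgn (series (fun n => C * L * c n)).
  rewrite (_ : series _ = fun n => C * L * series c n).
    by apply: is_cvgMl_tmp; exact: c_summable.
  by apply/funext => n; rewrite !series_ord mulr_sumr.
have dom r n : 0 <= r -> (1 <= n)%N -> `|smear_gap r n| <= C * L * c n.
  by move=> _; rewrite ger0_norm ?smear_gap_ge0//; case: n => // n _;
    rewrite /= ge_min lexx orbT.
have := near_dominated_sum cK dom smear_gap_cvg0 eps0.
apply: filterS => r h N; exact: le_trans (ler_norm _) (h N).
Qed.

(** What remains of the tilted expectation of expo r in the limit: the same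
    quantity for all weights whose squares add up to 1. *)
Definition gauss_value (r : R) : R := fine (smear phi 1 (expo r) 0).

Lemma gauss_valueE r : 0 < r -> (gauss_value r)%:E = smear phi 1 (expo r) 0.
Proof.
move=> r0; rewrite fineK//.
have [[_ v0] vB _] := bounded_lip_smear_expo ltr01 r0.
by rewrite ge0_fin_numE//; apply: le_lt_trans (vB 0) _; rewrite ltry.
Qed.

Lemma gauss_value_ge r : 1 <= r -> expR (-1) * phi 1 <= gauss_value r.
Proof.
move=> r1; rewrite -lee_fin gauss_valueE ?(lt_le_trans ltr01)//.
exact: smear_expo_ge.
Qed.

Lemma c_sq_lt1 N : \sum_(i < N) c i ^+ 2 < 1.
Proof.
apply: (@lt_le_trans _ _ (\sum_(i < N.+1) c i ^+ 2)).
  by rewrite big_ord_recr/= ltrDl exprn_gt0.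
have nd : nondecreasing_seq (series (fun n => c n ^+ 2)).
  by apply: nondecreasing_series => n _ _; exact: sqr_ge0.
have := nondecreasing_cvgn_le nd (cvgP _ c_unit) N.+1.
by rewrite (cvg_lim _ c_unit)// series_ord.
Qed.

(** Effect of the variance that the first N terms lack, which vanishes as N grows,
    and of evaluating at x instead of 0. *)
Definition shift_gap N (x : R) : R :=
  phi_moment * L * Num.sqrt (1 - \sum_(i < N) c i ^+ 2) + L * `|x|.

(** The error eps is uniform in N and x, which permits letting N grow first, for
    fixed r. *)
Lemma tilted_quotient_close eps : 0 < eps -> \forall r \near +oo, forall N x,
  let Q := smears (fun n => fold_density m (r * c n)) c N.+1 (expo r) x in
  (Q <= (gauss_value r + eps + shift_gap N.+1 x)%:E)%E /\
  ((gauss_value r)%:E <= Q + (eps + shift_gap N.+1 x)%:E)%E.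
Proof.
move=> eps0; near=> r.
have r0 : 0 < r by near: r; exact: nbhs_pinfty_gt.
have gap : forall N, \sum_(i < N) smear_gap r i <= eps.
  by near: r; exact: smear_gap_sum_small.
move=> N x.
have rc n : 0 <= r * c n by rewrite mulr_ge0 ?ltW.
have df n := prob_density_fold m0 (rc n).
have dw := nnmeas_expo r0.
have int1 : (\int[lebesgue_measure]_y expo r y = 1)%E by exact: integral_exponential_pdf.
have close0 : unif_close (smear_gap r 0) (smear (fold_density m (r * c 0%N)) (c 0%N) (expo r))
    (smear phi (c 0%N) (expo r)).
  have [d0 _ _] := df 0%N.
  apply: (smear_close_density d0 nndens_phi (nndens_fold_gap m (r * c 0%N)) dw).
    by move=> s; exact: fold_density_close.
  move=> y; rewrite -[smear_gap r 0]mulr1; apply: smear_le_sup => //.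
  + exact: nndens_fold_gap.
  + by rewrite mulr_ge0 ?fold_err_ge0// divr_ge0 ?mulr_ge0 ?phi_ge0.
  + by rewrite int1.
  + by move=> s; exact: fold_gap_le.
have closeS n v : bounded_lip B L v -> unif_close (smear_gap r n.+1)
    (smear (fold_density m (r * c n.+1)) (c n.+1) v) (smear phi (c n.+1) v).
  move=> lv; have [dv vB _] := lv; have [d0 _ _] := df n.+1.
  have h1 : unif_close (B * (4 / phi 1 * fold_err m (r * c n.+1)))
    (smear (fold_density m (r * c n.+1)) (c n.+1) v) (smear phi (c n.+1) v).
    apply: (smear_close_density d0 nndens_phi (nndens_fold_gap m (r * c n.+1)) dv).
      by move=> s; exact: fold_density_close.
    move=> y; apply: smear_le_mass => //; first exact: nndens_fold_gap.
    by rewrite integral_fold_gap.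
  have h2 := smear_near_id (df n.+1) (ltW (c0 n.+1)) L0 lv.
  have h3 := smear_near_id prob_density_phi (ltW (c0 n.+1)) L0 lv.
  have h4 : unif_close (C * L * c n.+1)
    (smear (fold_density m (r * c n.+1)) (c n.+1) v) (smear phi (c n.+1) v).
    move=> y; have [a1 a2] := h2 y; have [b1 b2] := h3 y.
    rewrite /C 2!mulrDl EFinD; split.
    + apply: le_trans a1 _; apply: le_trans (leeD2r _ b2) _.
      by rewrite -addeA [X in (_ + X)%E]addeC.
    + apply: le_trans b1 _; rewrite addeA; exact: leeD2r.
  by rewrite /smear_gap /Num.min; case: ifP.
have [close lip] := @smears_close R (fun n => fold_density m (r * c n)) c _ B L
  (smear_gap r) (expo r) df B0 L0 dw (smear_gap_ge0 r) close0
  (bounded_lip_smear_expo (c0 0%N) r0) closeS N.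
have [g1 g2] := smears_phi_near_unit x c0 L0 dw lip (c_sq_lt1 N.+1).
have [q1 q2] := close x.
rewrite -gauss_valueE// in g1 g2.
split.
- apply: le_trans q1 _.
  apply: (@le_trans _ _ ((gauss_value r)%:E + (shift_gap N.+1 x)%:E + eps%:E)%E).
    by apply: leeD => //; rewrite lee_fin.
  by rewrite -!EFinD lee_fin addrAC.
- apply: le_trans g2 _; rewrite (EFinD eps) addeA; apply: leeD2r.
  by apply: le_trans q2 _; apply: leeD2l; rewrite lee_fin.
Unshelve. all: by end_near. Qed.

End tilted_quotient.

(** * The infinite product of masses *)

Section limits_of_partial_data.
Context {R : realType}.
Variables (m : R) (c : nat -> R).
Hypothesis m0 : 0 <= m.
Hypothesis c0 : forall n, 0 < c n.
Hypothesis c_summable : cvgn (series c).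

Lemma log_mass_le : exists2 C, 0 <= C & forall t, 0 <= t -> `|log_mass m t| <= C * t.
Proof.
have [C C0 hC] := log_mass_bounds m0; exists C => // t.
rewrite le_eqVlt => /orP[/eqP <-|t0].
  by rewrite /log_mass fold_mass0// ln1 normr0 mulr0.
have [z /andP[z0 _] h] := mean_value t0
  (fun z hz => is_derive_log_mass m0 (proj1 (andP hz))).
have l0 : log_mass m 0 = 0 by rewrite /log_mass fold_mass0// ln1.
have [d _ _] := hC z (ltW z0).
move: h; rewrite l0 !subr0 => ->.
by rewrite normrM (gtr0_norm t0) ler_wpM2r// ltW.
Qed.

Lemma log_mass_summable r : 0 <= r -> cvgn (series (fun n => log_mass m (r * c n))).
Proof.
move=> r0; have [C C0 hC] := log_mass_le.
apply: normed_cvg; apply: (@series_le_cvg _ _ (fun n => C * r * c n)).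
- by move=> n /=; exact: normr_ge0.
- by move=> n; rewrite !mulr_ge0// ltW.
- by move=> n /=; rewrite -mulrA; apply: hC; rewrite mulr_ge0// ltW.
- rewrite (_ : series _ = fun n => C * r * series c n).
    by apply: is_cvgMl_tmp; exact: c_summable.
  by apply/funext => n; rewrite !series_ord mulr_sumr.
Qed.

Definition limit_mass r : R := expR (limn (series (fun n => log_mass m (r * c n)))).

Lemma prod_fold_mass r N : 0 <= r ->
  \prod_(i < N) fold_mass m (r * c i) = expR (series (fun n => log_mass m (r * c n)) N).
Proof.
move=> r0; rewrite series_ord expR_sum; apply: eq_bigr => i _.
by rewrite /log_mass lnK// posrE fold_mass_gt0// mulr_ge0// ltW.
Qed.

End limits_of_partial_data.

(** * Asymptotics of the tail probability *)

Section tail_of_folded_sum.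
Context d (T : measurableType d) (R : realType) (P : probability T R).
Variables (alpha beta : R) (Z : nat -> {RV P >-> R}) (c : nat -> R).
Hypothesis beta_gt0 : 0 < beta.
Hypothesis Z_indep : mutually_independent Z.
Hypothesis Z_law : forall n, has_law (Z n) (normal_prob alpha beta).
Hypothesis c0 : forall n, 0 < c n.
Hypothesis c_summable : cvgn (series c).
Hypothesis c_unit : series (fun n => c n ^+ 2) @ \oo --> (1 : R).

Let m := `|alpha| / beta.
Let g (z : R) := `|z| / beta - m.
Let S := partial_sum Z g c.

Lemma drift_ge0 : 0 <= m. Proof. by rewrite divr_ge0// ltW. Qed.

Lemma measurable_standardize : measurable_fun [set: R] g.
Proof. exact: measurable_norm_affine. Qed.

Lemma expectation_standardize n v : nnmeas v ->
  (\int[P]_w v (g (Z n w)) = \int[lebesgue_measure]_y (v y * (folded m y)%:E))%E.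
Proof.
move=> dv; have [mv v0] := dv.
have mvg : measurable_fun [set: R] (v \o g).
  exact: (measurableT_comp mv measurable_standardize).
have vg0 y : (0 <= (v \o g) y)%E by exact: v0.
rewrite -(integral_folded_normal alpha beta_gt0 dv).
have mZ : @measurable_fun _ _ T (measurableTypeR R) setT (Z n).
  exact: (@measurable_funPT _ _ T R (Z n)).
have lawE (A : set (measurableTypeR R)) : measurable A -> image_measure P mZ A =
    (\int[lebesgue_measure]_(y in A) (normal_pdf alpha beta y)%:E)%E.
  by move=> mA; exact: Z_law.
have := @ge0_integral_density _ (measurableTypeR R) R lebesgue_measure
  (image_measure P mZ) (normal_pdf alpha beta) (v \o g)
  (measurable_normal_pdf _ _) (normal_pdf_ge0 _ _) lawE mvg vg0.
by rewrite ge0_integral_image_measure.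
Qed.

Lemma measurable_tail_event N rho : measurable [set w | rho <= S N w].
Proof.
rewrite -[X in measurable X]setTI; apply: measurable_fun_le => //.
exact: (measurable_partial_sum Z c measurable_standardize).
Qed.

(** The rate of the tilting is r while the level rho is free, because the levels
    used for partial sums only tend to r. *)
Lemma tail_formula (r rho : R) N : 0 < r ->
  (r%:E * P [set w | (rho <= S N w)%R] =
   (expR (- (r * rho) + r ^+ 2 * (\sum_(i < N) c i ^+ 2) / 2 +
          series (fun n => log_mass m (r * c n)) N))%:E *
   smears (fun n => fold_density m (r * c n)) c N (expo r)
     (- rho + r * \sum_(i < N) c i ^+ 2)%R)%E.
Proof.
move=> r0.
pose v (y : R) : \bar R := (r * (0 <= y)%R%:R)%:E.
have vE : v = (fun y => (expR (r * y))%:E * expo r y)%E.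
  by apply/funext => y; exact: scaled_half_line.
have dv : nnmeas v.
  split=> [|y]; last by rewrite lee_fin mulr_ge0// ltW.
  rewrite vE; have [me _] := nnmeas_expo r0.
  apply: emeasurable_funM => //; apply/measurable_EFinP.
  by apply: measurableT_comp => //; exact: measurable_funM.
have dq : nndens (folded m) by exact: nndens_phi_fold_factor.
have tiltE := smears_tilt N (- rho) drift_ge0 (fun n => ltW (c0 n)) (ltW r0)
  (nnmeas_expo r0).
rewrite -vE prod_fold_mass -?expRD ?mulrN in tiltE; last 3 first.
- exact: drift_ge0.
- exact: c0.
- exact: ltW.
rewrite -tiltE.
rewrite -(@expectation_partial_sum _ _ _ P Z g c measurable_standardize Z_indep
  (folded m) dq expectation_standardize N v (- rho) dv).
rewrite -[X in (_ * P X)%E]setIT -integral_indic//; last exact: measurable_tail_event.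
rewrite -ge0_integralZl//=; last 2 first.
- by apply/measurable_EFinP; apply: measurable_indic; exact: measurable_tail_event.
- by rewrite lee_fin ltW.
apply: eq_integral => w _; rewrite /v -EFinM; congr (_ * _)%:E.
by rewrite indicE mem_setE/= addrC subr_ge0.
Qed.


Variable l : R.
Hypothesis l_gt0 : 0 < l.

Let tau := limn (series c).

Definition infinite_event (r : R) : set T :=
  [set w | ((r * l * beta + `|alpha| * limn (series (fun n => l * c n)))%:E <=
    \sum_(0 <= n <oo) (l * c n * `|Z n w|)%:E)%E].

(** The level for the sum of the first N centred terms that is equivalent to
    the level r + m * tau for the uncentred ones, lowered by a slack eps. *)
Definition threshold (r eps : R) N : R := r + m * (tau - series c N) - eps.

Definition finite_event (r eps : R) N : set T :=
  [set w | threshold r eps N <= S N w].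

Lemma levelE r : r * l * beta + `|alpha| * limn (series (fun n => l * c n)) =
  l * beta * (r + m * tau).
Proof.
have -> : limn (series (fun n => l * c n)) = l * tau.
  apply/cvg_lim => //.
  rewrite (_ : series _ = fun n => l * series c n); last first.
    by apply/funext => n; rewrite !series_ord mulr_sumr.
  by apply: cvgMl_tmp; exact: c_summable.
by rewrite /m; field; rewrite gt_eqF.
Qed.

Lemma weighted_partial_sum N w :
  \sum_(i < N) l * c i * `|Z i w| = l * beta * (S N w + m * series c N).
Proof.
rewrite series_ord /S /partial_sum mulr_sumr -big_split/= mulr_sumr.
by apply: eq_bigr => i _; rewrite /g; field; rewrite gt_eqF.
Qed.

Lemma finite_eventE r eps N w : finite_event r eps N w <->
  l * beta * (r + m * tau) - l * beta * eps <= \sum_(i < N) l * c i * `|Z i w|.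
Proof.
rewrite weighted_partial_sum -mulrBr ler_pM2l ?mulr_gt0//.
by rewrite /finite_event /threshold /=; split; lra.
Qed.

Lemma weight_ge0 i w : 0 <= l * c i * `|Z i w|.
Proof. by rewrite !mulr_ge0// ltW. Qed.

Lemma finite_event_nondecreasing r eps :
  {homo finite_event r eps : M N / (M <= N)%N >-> M `<=` N}.
Proof.
move=> M N MN w /finite_eventE h; apply/finite_eventE; apply: le_trans h _.
rewrite -(subnKC MN) (sum_split (fun i => l * c i * `|Z i w|)) lerDl.
by apply: sumr_ge0 => i _; exact: weight_ge0.
Qed.

Lemma partial_EFin N w : (\sum_(0 <= i < N) (l * c i * `|Z i w|)%:E)%E =
  (\sum_(i < N) l * c i * `|Z i w|)%:E.
Proof. by rewrite big_mkord sumEFin. Qed.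

Lemma finite_event_sub r N : finite_event r 0 N `<=` infinite_event r.
Proof.
move=> w /finite_eventE; rewrite mulr0 subr0 => h.
rewrite /infinite_event/= levelE.
apply: (@le_trans _ _ (\sum_(0 <= i < N) (l * c i * `|Z i w|)%:E)%E).
  by rewrite partial_EFin lee_fin.
by apply: nneseries_lim_ge => n _ _; rewrite lee_fin weight_ge0.
Qed.

(** With no slack the inclusion fails where the series equals the level without
    any partial sum reaching it; the slack is sent to 0 at the end. *)
Lemma infinite_event_sub r eps : 0 < eps ->
  infinite_event r `<=` \bigcup_N finite_event r eps N.
Proof.
move=> eps0 w; rewrite /infinite_event/= levelE => h; apply: contrapT => nh.
have le0 : 0 < l * beta * eps by rewrite !mulr_gt0.
suff : (\sum_(0 <= n <oo) (l * c n * `|Z n w|)%:E <=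
    (l * beta * (r + m * tau) - l * beta * eps)%:E)%E.
  by move=> /(le_trans h); rewrite lee_fin; lra.
apply: lime_le.
  by apply: is_cvg_nneseries => n _ _; rewrite lee_fin weight_ge0.
apply: nearW => N; rewrite partial_EFin lee_fin leNgt; apply/negP => hN.
by apply: nh; exists N => //; apply/finite_eventE; exact: ltW.
Qed.

Lemma measurable_infinite_event r : measurable (infinite_event r).
Proof.
rewrite /infinite_event -[X in measurable X]setTI.
apply: emeasurable_fun_c_infty => //.
apply: (@ge0_emeasurable_sum _ _ _ setT (fun n w => (l * c n * `|Z n w|)%:E) xpredT).
  by move=> n w _ _; rewrite lee_fin weight_ge0.
move=> n _; apply/measurable_EFinP; apply: measurable_funM => //.
by apply: measurableT_comp.
Qed.

Lemma measurable_finite_event r eps N : measurable (finite_event r eps N).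
Proof. exact: measurable_tail_event. Qed.

Definition infinite_tail (r : R) : R := fine (P (infinite_event r)).
Definition finite_tail (r eps : R) N : R := fine (P (finite_event r eps N)).

Lemma finite_tail_le r N : finite_tail r 0 N <= infinite_tail r.
Proof.
apply: fine_le; rewrite ?fin_num_measure//.
- exact: measurable_finite_event.
- exact: measurable_infinite_event.
apply: le_measure; rewrite ?inE.
- exact: measurable_finite_event.
- exact: measurable_infinite_event.
- exact: finite_event_sub.
Qed.

Lemma infinite_tail_le r eps (U : nat -> R) (u : R) : 0 < eps ->
  (\forall N \near \oo, finite_tail r eps N <= U N) -> U @ \oo --> u ->
  infinite_tail r <= u.
Proof.
move=> eps0 hU cU.
have mF N := measurable_finite_event r eps N.
have mU : measurable (\bigcup_N finite_event r eps N) by exact: bigcupT_measurable.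
have cF : finite_tail r eps @ \oo --> fine (P (\bigcup_N finite_event r eps N)).
  apply: fine_cvg; rewrite fineK ?fin_num_measure//.
  apply: nondecreasing_cvg_mu => //.
  by move=> M N MN; apply/subsetPset; exact: finite_event_nondecreasing.
apply: le_trans (ler_cvg_to cF cU hU).
apply: fine_le; rewrite ?fin_num_measure//; first exact: measurable_infinite_event.
apply: le_measure; rewrite ?inE//; first exact: measurable_infinite_event.
exact: infinite_event_sub.
Qed.

(** The exponent and the evaluation point that tail_formula yields at this
    level; the former includes the logarithm of the product of the masses. *)
Definition exponent (r eps : R) N : R := - (r * threshold r eps N) +
  r ^+ 2 * (\sum_(i < N) c i ^+ 2) / 2 + series (fun n => log_mass m (r * c n)) N.

Definition offset (r eps : R) N : R :=
  - threshold r eps N + r * \sum_(i < N) c i ^+ 2.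

Lemma finite_tail_bounds r e eps N : 0 < r ->
  (forall N x, let Q := smears (fun n => fold_density m (r * c n)) c N.+1 (expo r) x in
    (Q <= (gauss_value r + e + shift_gap c N.+1 x)%:E)%E /\
    ((gauss_value r)%:E <= Q + (e + shift_gap c N.+1 x)%:E)%E) ->
  r * finite_tail r eps N.+1 <= expR (exponent r eps N.+1) *
     (gauss_value r + e + shift_gap c N.+1 (offset r eps N.+1)) /\
  expR (exponent r eps N.+1) *
     (gauss_value r - e - shift_gap c N.+1 (offset r eps N.+1)) <=
  r * finite_tail r eps N.+1.
Proof.
move=> r0 hQ; have [q1 q2] := hQ N (offset r eps N.+1).
set Q := smears _ _ _ _ _ in q1 q2.
have E0 := expR_gt0 (exponent r eps N.+1).
have tE := tail_formula (threshold r eps N.+1) N.+1 r0.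
rewrite -/(exponent r eps N.+1) -/(offset r eps N.+1) -/Q in tE.
have PE : P (finite_event r eps N.+1) = (finite_tail r eps N.+1)%:E.
  by rewrite /finite_tail fineK// fin_num_measure//; exact: measurable_finite_event.
rewrite -/(finite_event r eps N.+1) PE -EFinM in tE.
rewrite -!lee_fin tE !EFinM; split.
  by apply: lee_wpmul2l => //; rewrite lee_fin ltW.
apply: lee_wpmul2l; first by rewrite lee_fin ltW.
by move: q2; rewrite -leeBlDr// -EFinB opprD addrA.
Qed.

Lemma sq_cvg : (\sum_(i < N) c i ^+ 2) @[N --> \oo] --> (1 : R).
Proof.
rewrite (_ : (fun N => _) = series (fun n => c n ^+ 2))//.
by apply/funext => N; rewrite series_ord.
Qed.

Lemma threshold_cvg r eps : threshold r eps N @[N --> \oo] --> r - eps.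
Proof.
rewrite /threshold -[X in _ --> X - _]addr0; apply: cvgB; last exact: cvg_cst.
apply: cvgD; first exact: cvg_cst.
rewrite -[X in _ --> X](mulr0 m) -(subrr tau); apply: cvgMl_tmp.
by apply: cvgB; [exact: cvg_cst|exact: c_summable].
Qed.


Lemma offset_cvg r eps : offset r eps N @[N --> \oo] --> eps.
Proof.
rewrite [X in _ --> X](_ : eps = - (r - eps) + r * 1); last by ring.
by apply: cvgD; [apply: cvgN; exact: threshold_cvg|apply: cvgMl_tmp; exact: sq_cvg].
Qed.

Definition tail_scale r : R := expR (- (r ^+ 2 / 2)) * limit_mass m c r.

Lemma exponent_cvg r eps : 0 <= r ->
  expR (exponent r eps N) @[N --> \oo] --> expR (r * eps) * tail_scale r.
Proof.
move=> r0; rewrite /tail_scale mulrA -!expRD.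
apply: continuous_cvg; first exact: continuous_expR.
rewrite (_ : r * eps - r ^+ 2 / 2 = - (r * (r - eps)) + r ^+ 2 * 1 / 2); last by field.
have h := log_mass_summable drift_ge0 c0 c_summable r0.
apply: cvgD; last exact: h.
apply: cvgD; last by apply: cvgMr_tmp; apply: cvgMl_tmp; exact: sq_cvg.
by apply: cvgN; apply: cvgMl_tmp; exact: threshold_cvg.
Qed.


Lemma shift_gap_cvg r eps : 0 <= eps ->
  shift_gap c N (offset r eps N) @[N --> \oo] --> phi 0 / c 0%N ^+ 2 * eps.
Proof.
move=> eps0; rewrite /shift_gap -[X in _ --> X]add0r; apply: cvgD.
  rewrite [X in _ --> X](_ : 0 =
    phi_moment * (phi 0 / c 0%N ^+ 2) * Num.sqrt (1 - 1)); last first.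
    by rewrite subrr sqrtr0 mulr0.
  apply: cvgMl_tmp; apply: continuous_cvg; first exact: sqrt_continuous.
  by apply: cvgB; [exact: cvg_cst|exact: sq_cvg].
apply: cvgMl_tmp; rewrite -[X in _ --> X](ger0_norm eps0).
by apply: cvg_norm; exact: offset_cvg.
Qed.

Lemma tail_scale_gt0 r : 0 < tail_scale r.
Proof. by rewrite mulr_gt0 ?expR_gt0. Qed.

(** For fixed r the number of terms goes to infinity, with slack 0 for the lower
    bound and with a positive slack for the upper bound; the slack then goes to
    0. *)
Lemma tail_asymptotics e : 0 < e -> \forall r \near +oo,
  (gauss_value r - e) * tail_scale r <= r * infinite_tail r <=
  (gauss_value r + e) * tail_scale r.
Proof.
move=> e0; near=> r.
have r0 : 0 < r by near: r; exact: nbhs_pinfty_gt.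
have hQ : forall N x, let Q := smears (fun n => fold_density m (r * c n)) c N.+1 (expo r) x in
    (Q <= (gauss_value r + e + shift_gap c N.+1 x)%:E)%E /\
    ((gauss_value r)%:E <= Q + (e + shift_gap c N.+1 x)%:E)%E.
  by near: r; exact: (tilted_quotient_close drift_ge0 c0 c_summable c_unit e0).
have bounds eps N := @finite_tail_bounds r e eps N r0 hQ.
have cc : r * infinite_tail r @[_ --> \oo] --> r * infinite_tail r by exact: cvg_cst.
apply/andP; split.
- have cl : expR (exponent r 0 N) *
     (gauss_value r - e - shift_gap c N (offset r 0 N)) @[N --> \oo] -->
     expR (r * 0) * tail_scale r * (gauss_value r - e - phi 0 / c 0%N ^+ 2 * 0).
    apply: cvgM; first exact: exponent_cvg (ltW r0).
    by apply: cvgB; [exact: cvg_cst|exact: shift_gap_cvg].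
  have H : expR (r * 0) * tail_scale r * (gauss_value r - e - phi 0 / c 0%N ^+ 2 * 0) <=
      r * infinite_tail r.
    apply: (ler_cvg_to cl cc); exists 1%N => // -[//|N] _ /=.
    apply: le_trans (proj2 (bounds 0 N)) _.
    by rewrite ler_wpM2l ?(ltW r0)// finite_tail_le.
  by rewrite !mulr0 expR0 mul1r subr0 mulrC in H.
- have up eps : 0 < eps -> r * infinite_tail r <=
      expR (r * eps) * tail_scale r * (gauss_value r + e + phi 0 / c 0%N ^+ 2 * eps).
    move=> eps0; rewrite -ler_pdivlMl//.
    pose U N := r^-1 * (expR (exponent r eps N) *
     (gauss_value r + e + shift_gap c N (offset r eps N))).
    apply: (@infinite_tail_le r eps U) => //.
      exists 1%N => // -[//|N] _ /=.
      by rewrite /U ler_pdivlMl//; case: (bounds eps N).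
    apply: cvgMl_tmp; apply: cvgM; first exact: exponent_cvg (ltW r0).
    by apply: cvgD; [exact: cvg_cst|exact: shift_gap_cvg (ltW eps0)].
  have cu : expR (r * harmonic N) * tail_scale r *
      (gauss_value r + e + phi 0 / c 0%N ^+ 2 * harmonic N) @[N --> \oo] -->
      expR (r * 0) * tail_scale r * (gauss_value r + e + phi 0 / c 0%N ^+ 2 * 0).
    apply: cvgM.
      apply: cvgMr_tmp; apply: continuous_cvg; first exact: continuous_expR.
      by apply: cvgMl_tmp; exact: cvg_harmonic.
    by apply: cvgD; [exact: cvg_cst|apply: cvgMl_tmp; exact: cvg_harmonic].
  have H : r * infinite_tail r <=
      expR (r * 0) * tail_scale r * (gauss_value r + e + phi 0 / c 0%N ^+ 2 * 0).
    apply: (ler_cvg_to cc cu); apply: nearW => N; apply: up.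
    by rewrite /harmonic/= invr_gt0.
  by rewrite !mulr0 expR0 mul1r addr0 [_ * (_ + _)]mulrC in H.
Unshelve. all: by end_near. Qed.

End tail_of_folded_sum.

(** * Comparison of the two tails *)

Section normalized_tail.
Context d (T : measurableType d) (R : realType) (P : probability T R).
Variables (alpha beta : R) (Z : nat -> {RV P >-> R}) (c : nat -> R) (l : R).
Hypothesis beta_gt0 : 0 < beta.
Hypothesis Z_indep : mutually_independent Z.
Hypothesis Z_law : forall n, has_law (Z n) (normal_prob alpha beta).
Hypothesis c0 : forall n, 0 < c n.
Hypothesis c_summable : cvgn (series c).
Hypothesis c_unit : series (fun n => c n ^+ 2) @ \oo --> (1 : R).
Hypothesis l_gt0 : 0 < l.

(** The absolute error of tail_asymptotics becomes a relative one because
    gauss_value stays away from 0. *)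
Lemma normalized_tail_cvg :
  r * infinite_tail alpha beta Z c l r /
    (gauss_value r * tail_scale alpha beta c r) @[r --> +oo] --> (1 : R).
Proof.
have j0 : 0 < expR (-1) * phi 1 :> R by rewrite mulr_gt0 ?expR_gt0 ?phi_gt0.
apply/cvgrPdist_le => e e0; near=> r.
have r1 : 1 <= r by near: r; apply: nbhs_pinfty_ge; exact: num_real.
have J := gauss_value_ge r1; have J0 := lt_le_trans j0 J.
have A0 := tail_scale_gt0 alpha beta c r.
have : (gauss_value r - e * (expR (-1) * phi 1)) * tail_scale alpha beta c r <=
    r * infinite_tail alpha beta Z c l r <=
    (gauss_value r + e * (expR (-1) * phi 1)) * tail_scale alpha beta c r.
  near: r; apply: tail_asymptotics => //; exact: mulr_gt0.
move=> /andP[lo hi].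
have JA : 0 < gauss_value r * tail_scale alpha beta c r by exact: mulr_gt0.
have Je : e * (expR (-1) * phi 1) * tail_scale alpha beta c r <=
    e * (gauss_value r * tail_scale alpha beta c r).
  by rewrite -mulrA ler_wpM2l ?(ltW e0)// ler_wpM2r// ltW.
rewrite distrC ler_distl; apply/andP; split.
  by rewrite ler_pdivlMr// mulrBl mul1r; rewrite mulrBl in lo; lra.
by rewrite ler_pdivrMr// mulrDl mul1r; rewrite mulrDl in hi; lra.
Unshelve. all: by end_near. Qed.

End normalized_tail.

Section mass_ratio.
Context {R : realType}.
Variables (alpha beta : R) (u v : nat -> R).
Hypothesis beta_gt0 : 0 < beta.
Hypothesis u0 : forall n, 0 < u n.
Hypothesis v0 : forall n, 0 < v n.
Hypothesis v_noninc : nonincreasing_seq v.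
Hypothesis u_summable : cvgn (series u).
Hypothesis v_summable : cvgn (series v).
Hypothesis ratio_cvg : cvgn (series (fun n => 1 - u n / v n)).
Hypothesis ratio_sq_cvg : cvgn (series (fun n => (1 - u n / v n) ^+ 2)).

Lemma tail_scale_ratio_cvg :
  tail_scale alpha beta u r / tail_scale alpha beta v r @[r --> +oo] --> (1 : R).
Proof.
have m0 : 0 <= `|alpha| / beta by exact: drift_ge0.
set m := `|alpha| / beta in m0.
pose Lam w r := limn (series (fun n => log_mass m (r * w n))).
have LamE r : tail_scale alpha beta u r / tail_scale alpha beta v r =
    expR (Lam u r - Lam v r).
  rewrite /tail_scale /limit_mass -/m -/(Lam u r) -/(Lam v r) expRB.
  by rewrite -mulf_div divff ?mul1r// gt_eqF ?expR_gt0.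
rewrite (funext LamE) -expR0; apply: continuous_cvg; first exact: continuous_expR.
apply/cvgrPdist_le => e e0; near=> r; rewrite sub0r normrN.
have r0 : 0 <= r by near: r; apply: nbhs_pinfty_ge; exact: num_real.
have hN : forall N, `|\sum_(i < N) (log_mass m (r * u i) - log_mass m (r * v i))| <= e.
  near: r.
  exact: (log_mass_sum_close m0 u0 v0 v_noninc ratio_cvg ratio_sq_cvg e0).
have cu := log_mass_summable m0 u0 u_summable r0.
have cv := log_mass_summable m0 v0 v_summable r0.
have cd := cvg_norm (cvgB cu cv).
have ce : e @[_ --> \oo] --> e by exact: cvg_cst.
have H := ler_cvg_to (cd _ _) ce.
apply: H; apply: nearW => N.
by rewrite !fctE !series_ord -sumrB.
Unshelve. all: by end_near. Qed.

End mass_ratio.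

Section normalization.
Context {R : realType}.
Variable a : nat -> R.
Hypothesis a_gt0 : forall n, 0 < a n.
Hypothesis a_noninc : nonincreasing_seq a.
Hypothesis a_summable : cvgn (series a).

Lemma square_summable : cvgn (series (fun n => a n ^+ 2)).
Proof.
apply: (@series_le_cvg _ _ (fun n => a 0%N * a n)).
- by move=> n; exact: sqr_ge0.
- by move=> n; rewrite mulr_ge0// ltW.
- by move=> n; rewrite expr2 ler_wpM2r ?(ltW (a_gt0 n))// a_noninc.
- rewrite (_ : series _ = fun n => a 0%N * series a n).
    by apply: is_cvgMl_tmp; exact: a_summable.
  by apply/funext => n; rewrite !series_ord mulr_sumr.
Qed.

Lemma l2norm_gt0 : 0 < l2norm a.
Proof.
rewrite sqrtr_gt0.
have nd : nondecreasing_seq (series (fun n => a n ^+ 2)).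
  by apply: nondecreasing_series => n _ _; exact: sqr_ge0.
apply: lt_le_trans (nondecreasing_cvgn_le nd square_summable 1%N).
by rewrite series_ord big_ord_recl big_ord0 addr0 exprn_gt0.
Qed.

Lemma normalized_gt0 n : 0 < a n / l2norm a.
Proof. by rewrite divr_gt0// l2norm_gt0. Qed.

Lemma normalized_summable : cvgn (series (fun n => a n / l2norm a)).
Proof.
rewrite (_ : series _ = fun n => series a n * (l2norm a)^-1).
  by apply: is_cvgMr_tmp; exact: a_summable.
by apply/funext => n; rewrite !series_ord mulr_suml.
Qed.

Lemma normalized_unit : series (fun n => (a n / l2norm a) ^+ 2) @ \oo --> (1 : R).
Proof.
have L0 := l2norm_gt0.
rewrite (_ : series _ = fun n => series (fun n => a n ^+ 2) n * (l2norm a)^-1 ^+ 2);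
  last first.
  apply/funext => n; rewrite !series_ord mulr_suml.
  by apply: eq_bigr => i _; rewrite exprMn.
have sE : l2norm a ^+ 2 = limn (series (fun n => a n ^+ 2)).
  by rewrite sqr_sqrtr// ltW// -sqrtr_gt0.
rewrite [X in _ --> X](_ : 1 = l2norm a ^+ 2 * (l2norm a)^-1 ^+ 2); last first.
  by rewrite -exprMn divff ?gt_eqF// expr1n.
by rewrite {1}sE; apply: cvgMr_tmp; exact: square_summable.
Qed.

Lemma normalized_noninc : nonincreasing_seq (fun n => a n / l2norm a).
Proof.
by move=> i j ij; rewrite ler_wpM2r// ?a_noninc// invr_ge0 ltW// l2norm_gt0.
Qed.

Lemma tail_probE d (T : measurableType d) (P : probability T R)
    (Z : nat -> {RV P >-> R}) alpha beta r :
  tail_prob Z a (r * l2norm a * beta + `|alpha| * limn (series a)) =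
  infinite_tail alpha beta Z (fun n => a n / l2norm a) (l2norm a) r.
Proof.
have aE n : l2norm a * (a n / l2norm a) = a n.
  by rewrite mulrCA divff ?mulr1// gt_eqF// l2norm_gt0.
rewrite /tail_prob /infinite_tail /infinite_event (funext aE).
congr (fine (P _)); apply/funext => w /=; congr (is_true (_ <= _)%E).
by apply: eq_eseriesr => n _; rewrite aE.
Qed.

End normalization.

Theorem theorem2p2 (R : realType) (d : measure_display) (T : measurableType d)
    (P : probability T R) (alpha beta : R) (Z : nat -> {RV P >-> R})
    (a b : R^nat)
    (beta_gt0 : 0 < beta)
    (Z_indep : mutually_independent Z)
    (Z_law : forall n, has_law (Z n) (normal_prob alpha beta))
    (a_gt0 : forall n, 0 < a n)
    (b_gt0 : forall n, 0 < b n)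
    (a_noninc : nonincreasing_seq a)
    (b_noninc : nonincreasing_seq b)
    (a_summable : cvgn (series a))
    (b_summable : cvgn (series b))
    (ratio_cvg : cvgn (series (fun n =>
       1 - (a n / l2norm a) / (b n / l2norm b))))
    (ratio_sq_cvg : cvgn (series (fun n =>
       (1 - (a n / l2norm a) / (b n / l2norm b)) ^+ 2))) :
  asymp_equiv
    (fun r => tail_prob Z a
       (r * l2norm a * beta + `|alpha| * limn (series a)))
    (fun r => tail_prob Z b
       (r * l2norm b * beta + `|alpha| * limn (series b))).
Proof.
pose u n := a n / l2norm a; pose v n := b n / l2norm b.
have a2 := l2norm_gt0 a_gt0 a_noninc a_summable.
have b2 := l2norm_gt0 b_gt0 b_noninc b_summable.
have u0 := normalized_gt0 a_gt0 a_noninc a_summable.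
have v0 := normalized_gt0 b_gt0 b_noninc b_summable.
have us := normalized_summable a_summable.
have vs := normalized_summable b_summable.
have cu := normalized_tail_cvg beta_gt0 Z_indep Z_law u0 us
  (normalized_unit a_gt0 a_noninc a_summable) a2.
have cv := normalized_tail_cvg beta_gt0 Z_indep Z_law v0 vs
  (normalized_unit b_gt0 b_noninc b_summable) b2.
have cs := tail_scale_ratio_cvg alpha beta_gt0 u0 v0
  (normalized_noninc b_gt0 b_noninc b_summable) us vs ratio_cvg ratio_sq_cvg.
pose pa := infinite_tail alpha beta Z u (l2norm a).
pose pb := infinite_tail alpha beta Z v (l2norm b).
pose X r := r * pa r / (gauss_value r * tail_scale alpha beta u r) *
  (tail_scale alpha beta u r / tail_scale alpha beta v r) *
  (r * pb r / (gauss_value r * tail_scale alpha beta v r))^-1.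
have lim : X r @[r --> +oo] --> (1 : R).
  have h := cvgM (cvgM cu cs) (cvgV (@oner_neq0 R) cv).
  by rewrite invr1 !mulr1 in h; exact: h.
have cancel (x p q j s t : R) : x != 0 -> q != 0 -> j != 0 -> s != 0 -> t != 0 ->
    x * p / (j * s) * (s / t) * (x * q / (j * t))^-1 = p / q.
  by move=> x0 q0 j0 s0 t0; field; rewrite x0 q0 j0 s0 t0.
rewrite /asymp_equiv; apply: cvg_trans lim; apply: near_eq_cvg; near=> r.
have r1 : 1 <= r by near: r; apply: nbhs_pinfty_ge; exact: num_real.
have r0 : 0 < r by exact: lt_le_trans r1.
have J0 : 0 < gauss_value r :> R.
  apply: lt_le_trans (gauss_value_ge r1).
  by rewrite mulr_gt0 ?expR_gt0 ?phi_gt0.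
have A0 := tail_scale_gt0 alpha beta u r.
have B0 := tail_scale_gt0 alpha beta v r.
rewrite !tail_probE// -/u -/v -/(pa r) -/(pb r) /X.
have [->|pb0] := eqVneq (pb r) 0; first by rewrite mulr0 mul0r !invr0 !mulr0.
exact: (cancel _ _ _ _ _ _ (lt0r_neq0 r0) pb0 (lt0r_neq0 J0)
  (lt0r_neq0 A0) (lt0r_neq0 B0)).
Unshelve. all: by end_near. Qed.
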